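(* Let $K$ be a field with $\mathrm{char}(K)\neq 2$ and let $q$ be a quadratic form of type $E_7$ or $E_8$ over $K$. Then the algebraic group $\mathrm{PGO}_+(q)$ is $R$-trivial.
   Context: A quadratic space $(K,L,q)$ is of type $E_7$ (resp. $E_8$) if it is anisotropic and there exist a separable quadratic extension $E/K$ with norm form $N$ and scalars $\alpha_1,\dots,\alpha_d\in K^\times$, with $d=4$ (resp. $d=6$), such that $q\cong \alpha_1N\perp\cdots\perp\alpha_dN$ and $\alpha_1\alpha_2\alpha_3\alpha_4\notin N(E)$ (resp. $-\alpha_1\alpha_2\cdots\alpha_6\in N(E)$). $\mathrm{PGO}_+(q)$ is the connected component of the identity in the group of projective similitudes of $q$, i.e. in the algebraic group of algebra automorphisms of $\mathrm{End}(L)$ that commute with the adjoint involution of $q$. For a linear algebraic group $H$ over $K$ and a field extension $F/K$, two points of $H(F)$ are directly $R$-equivalent if they are the values at $0$ and $1$ of a rational map $\mathbb{A}^1_F\dashrightarrow H_F$ defined at $0$ and $1$; Manin's $R$-equivalence is the equivalence relation this generates. $H$ is $R$-trivial if $H(F)$ consists of a single $R$-equivalence class for every field extension $F/K$. *)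

(* Defs.v *)
From HB Require Import structures.
From Stdlib Require Relation_Operators.
From mathcomp Require Import all_boot all_order all_algebra all_field.
From mathcomp Require Import boolp classical_sets topology.
(* The notations of mpoly clash with those of topology. *)
From mathcomp Require Import -(notations) mpoly.

Set Implicit Arguments.
Unset Strict Implicit.
Unset Printing Implicit Defensive.

Import GRing.Theory.
Local Open Scope classical_set_scope.
Local Open Scope ring_scope.

Definition polar (K : fieldType) (V : lmodType K) (q : V -> K) (u v : V) : K :=
  q (u + v) - q u - q v.

(* The polar form is symmetric, so linearity on the left suffices. *)
Definition quadratic_form (K : fieldType) (V : lmodType K) (q : V -> K) : Prop :=
  (forall (a : K) (v : V), q (a *: v) = a ^+ 2 * q v) /\
  (forall (a : K) (u v w : V),
     polar q (a *: u + v) w = a * polar q u w + polar q v w).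

Definition anisotropic (K : fieldType) (V : lmodType K) (q : V -> K) : Prop :=
  forall v : V, q v = 0 -> v = 0.

Definition isometric (K : fieldType) (V W : lmodType K)
    (q : V -> K) (r : W -> K) : Prop :=
  exists f : {linear V -> W}, bijective f /\ forall v : V, r (f v) = q v.

Definition separable_quadratic_ext (K : fieldType) (E : fieldExtType K) : Prop :=
  \dim {:E} = 2%N /\ separable 1%VS {:E}.

(* The norm N_{E/K}(x) is the determinant of multiplication by x on the K-vector
   space E; for E/K quadratic separable it is x times its conjugate. *)
Definition norm_form (K : fieldType) (E : fieldExtType K) (x : E) : K :=
  \det (passmx.mxof (vbasis {:E}) (vbasis {:E}) (amull x)).

Definition scaled_norm_sum (K : fieldType) (E : fieldExtType K) (d : nat)
    (a : 'I_d -> K) (x : {ffun 'I_d -> E}) : K :=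
  \sum_(i < d) a i * norm_form (x i).

Definition type_E7 (K : fieldType) (V : lmodType K) (q : V -> K) : Prop :=
  anisotropic q /\
  exists (E : fieldExtType K) (a : 'I_4 -> K),
    [/\ separable_quadratic_ext E,
        forall i, a i != 0,
        isometric q (@scaled_norm_sum K E 4 a)
      & ~ exists x : E, norm_form x = \prod_i a i].

Definition type_E8 (K : fieldType) (V : lmodType K) (q : V -> K) : Prop :=
  anisotropic q /\
  exists (E : fieldExtType K) (a : 'I_6 -> K),
    [/\ separable_quadratic_ext E,
        forall i, a i != 0,
        isometric q (@scaled_norm_sum K E 6 a)
      & exists x : E, norm_form x = - \prod_i a i].

(* Points of the scheme A^N over K: a point is an equivalence class of F-valued
   points x, for F/K a field extension, and it is determined by the prime ideal
   of the polynomials that vanish at x. *)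
Record affine_point (K : fieldType) (N : nat) := AffinePoint {
  point_ideal : set (mpoly N K);
  point_idealP : exists (F : fieldType) (i : {rmorphism K -> F}) (x : 'rV[F]_N),
    point_ideal = [set p | mmap i (x 0) p = 0]
}.

Definition point_of (K : fieldType) (N : nat) (F : fieldType)
    (i : {rmorphism K -> F}) (x : 'rV[F]_N) : affine_point K N :=
  @AffinePoint K N [set p | mmap i (x 0) p = 0]
    (ex_intro _ F (ex_intro _ i (ex_intro _ x erefl))).

HB.instance Definition _ (K : fieldType) (N : nat) :=
  gen_eqMixin (affine_point K N).
HB.instance Definition _ (K : fieldType) (N : nat) :=
  gen_choiceMixin (affine_point K N).

Definition principal_open (K : fieldType) (N : nat) (p : mpoly N K) :
    set (affine_point K N) := [set P | ~ point_ideal P p].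

(* The Zariski topology, generated by the principal open sets. *)
HB.instance Definition _ (K : fieldType) (N : nat) :=
  isSubBaseTopological.Build (affine_point K N)
    (range (@principal_open K N)) id.

(* A subscheme X of A^N over K enters through its field-valued points: the set
   X(F) for every field extension F/K. *)
Definition field_points (K : fieldType) (N : nat) : Type :=
  forall F : fieldType, {rmorphism K -> F} -> set 'rV[F]_N.

Definition underlying_space (K : fieldType) (N : nat) (X : field_points K N) :
    set (affine_point K N) :=
  [set P | exists (F : fieldType) (i : {rmorphism K -> F}) (x : 'rV[F]_N),
     X F i x /\ P = point_of i x].

(* The connected component of the K-rational point e of X is open in X, hence
   an F-valued point of X factors through it exactly when its image lies in it. *)
Definition component (K : fieldType) (N : nat) (X : field_points K N)
    (e : 'rV[K]_N) : field_points K N :=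
  fun F i => [set x | X F i x /\
    connected_component (underlying_space X) (point_of idfun e) (point_of i x)].

Definition to_ratfun (K F : fieldType) (i : {rmorphism K -> F}) :
    {rmorphism K -> {fraction {poly F}}} :=
  @FracField.tofrac {poly F} \o (@polyC F \o i).

Definition takes_value (F : fieldType) (f : {fraction {poly F}}) (a v : F) : Prop :=
  exists p d : {poly F},
    [/\ d.[a] != 0, f = FracField.tofrac p / FracField.tofrac d & v = p.[a] / d.[a]].

(* A rational map from the affine line over F to X is an F(t)-valued point of X;
   it is defined at a if its coordinates are regular at a and its value there
   lies in X. *)
Definition directly_R_equivalent (K : fieldType) (N : nat) (X : field_points K N)
    (F : fieldType) (i : {rmorphism K -> F}) (x y : 'rV[F]_N) : Prop :=
  [/\ X F i x, X F i y
    & exists f : 'rV[{fraction {poly F}}]_N,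
        [/\ X {fraction {poly F}} (to_ratfun i) f,
            forall k, takes_value (f 0 k) 0 (x 0 k)
          & forall k, takes_value (f 0 k) 1 (y 0 k)]].

Definition R_equivalent (K : fieldType) (N : nat) (X : field_points K N)
    (F : fieldType) (i : {rmorphism K -> F}) : 'rV[F]_N -> 'rV[F]_N -> Prop :=
  Relation_Operators.clos_refl_sym_trans _ (directly_R_equivalent X i).

Definition R_trivial (K : fieldType) (N : nat) (X : field_points K N) : Prop :=
  forall (F : fieldType) (i : {rmorphism K -> F}),
    exists x, X F i x /\ forall y, X F i y -> R_equivalent X i x y.

Definition gram (K : fieldType) (n : nat) (q : 'cV[K]_n -> K) : 'M[K]_n :=
  \matrix_(i, j) polar q (delta_mx i 0) (delta_mx j 0).

(* The adjoint involution s of the bilinear form b with Gram matrix B, for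
   'M_n acting on column vectors: b (A u) v = b u (s A v). *)
Definition adjoint_involution (F : fieldType) (n : nat) (B A : 'M[F]_n) : 'M[F]_n :=
  invmx B *m A^T *m B.

(* G encodes the linear endomorphism A |-> endo G A of 'M_n. *)
Definition endo (F : fieldType) (n : nat) (G : 'M[F]_(n * n)) (A : 'M[F]_n) :
    'M[F]_n := vec_mx (mxvec A *m G).

Definition involution_automorphism (F : fieldType) (n : nat) (B : 'M[F]_n)
    (G : 'M[F]_(n * n)) : Prop :=
  [/\ G \in unitmx,
      endo G 1%:M = 1%:M,
      forall A C : 'M[F]_n, endo G (A *m C) = endo G A *m endo G C
    & forall A : 'M[F]_n,
        endo G (adjoint_involution B A) = adjoint_involution B (endo G A)].

Definition PGO (K : fieldType) (n : nat) (q : 'cV[K]_n -> K) :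
    field_points K ((n * n) * (n * n)) :=
  fun F i => [set x | involution_automorphism (map_mx i (gram q)) (vec_mx x)].

Definition PGO_plus (K : fieldType) (n : nat) (q : 'cV[K]_n -> K) :
    field_points K ((n * n) * (n * n)) :=
  component (PGO q) (mxvec 1%:M).

(* Main.v *)
From HB Require Import structures.
From Stdlib Require Relation_Operators.
Require Import Defs.
From mathcomp Require Import all_boot all_order all_algebra all_field.
From mathcomp Require Import perm ring.
From mathcomp Require Import boolp classical_sets topology.
From mathcomp Require Import -(notations) mpoly.
Import GRing.Theory.
Local Open Scope ring_scope.

Set Implicit Arguments.
Unset Strict Implicit.
Unset Printing Implicit Defensive.

(** Let F be an extension of K, B the Gram matrix of q over F, 2m the dimension
of q, and E = K(sqrt d), with norm form N(r + s sqrt d) = r^2 - d s^2.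

By Skolem-Noether, an F-point of PGO(q) is conjugation by a similitude g,
g^T B g = mu B ([similitude_of_automorphism]). The quotient det g / mu^m is a
regular function on PGO(q) with values 1 and -1 ([sign_polynomial]), so that it
is 1 on the connected component of the identity ([sign_PGO_plus]). Conversely, a
similitude over F[t] whose multiplier does not vanish at 0 and 1 is a rational
curve on PGO(q); its generic point specializes to both ends, so the ends and the
generic point lie in one connected component ([path_directly_R_equivalent]).
Hence it suffices to join every g with det g = mu^m to a scalar by a polynomial
similitude ([polynomial_path]). Such paths can be multiplied, and a product of
two reflections has one: move one of the two vectors linearly to the other. By
Cartan-Dieudonne this settles isometries of determinant 1 ([path_isometry]).

There remain the multipliers: if lam is the multiplier of some similitude of q
over F, then lam, up to squares, must be the multiplier of the end of a path that
starts at 1. If lam = N(z), multiply by (1 - t) + t z. If lam is not a norm, take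
an anisotropic vector v. The plane over F[sqrt d] that v and g v span carries the
form a (N - x N), where lam = N(u) - x: it is a scaled copy of the reduced norm of
the quaternion algebra Q = (d, x), and lam is the reduced norm of z = u + j. By
Witt's theorem g can be corrected so as to preserve the complement, and q splits
into two such blocks (type E7) or three (type E8) ([next_block]). Right
multiplication by z_i in the i-th block is a similitude, and it must be joined to
1 through quaternions z_i(t) with a common reduced norm. For two blocks the
tensor product of F[z_1] and F[z_2] contains w = (1 - t) + t (z_1 + z_2), whose
partial norms z_1(t) and z_2(t) have the same norm; at t = 1 they are z_1 and z_2
times the sum of the traces ([common_norm2]). Up to signs this sum is nonzero,
unless all traces vanish, and then the segments from 1 to z_i serve. For three
blocks, the condition on the discriminant in type E8 makes x_1 x_2 x_3 a norm
([three_blocks_discriminant]), so that the tensor product of Q_1 and Q_2 is the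
matrix algebra M_2(Q_3). The Dieudonne determinant of w in this algebra is the
required element z_3(t), after clearing a denominator ([common_norm3]). *)

(** * Similitudes, reflections and the theorems of Witt and Cartan-Dieudonne *)

Definition bil (R : comNzRingType) (n : nat) (B : 'M[R]_n) (v w : 'cV[R]_n) : R :=
  (v^T *m B *m w) 0 0.

Definition similitude (R : comNzRingType) (n : nat) (B g : 'M[R]_n) (mu : R) :=
  g^T *m B *m g = mu *: B.

(** The reflection in v multiplied by [bil B v v]; being free of denominators,
it makes sense over a polynomial ring. *)
Definition scaled_reflection (R : comNzRingType) (n : nat) (B : 'M[R]_n)
    (v : 'cV[R]_n) : 'M[R]_n :=
  bil B v v *: 1%:M - 2 *: (v *m v^T *m B).

Section Bil.
Variables (R : comNzRingType) (n : nat) (B : 'M[R]_n).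
Implicit Types (u v w : 'cV[R]_n) (a : R) (g h : 'M[R]_n).

Lemma bilE v w : v^T *m B *m w = (bil B v w)%:M.
Proof. by rewrite [LHS]mx11_scalar. Qed.

Lemma bil_col r s (X : 'M[R]_(n, r)) (Y : 'M[R]_(n, s)) i j :
  (X^T *m B *m Y) i j = bil B (col i X) (col j Y).
Proof.
have -> (M : 'M_(r, s)) : M i j = row i (col j M) 0 0 by rewrite !mxE.
by rewrite /bil tr_col [col j _]colE -mulmxA -colE !row_mul.
Qed.

Lemma bilDl u v w : bil B (u + v) w = bil B u w + bil B v w.
Proof. by rewrite /bil linearD /= !mulmxDl mxE. Qed.
Lemma bilDr u v w : bil B u (v + w) = bil B u v + bil B u w.
Proof. by rewrite /bil mulmxDr mxE. Qed.
Lemma bilZl a v w : bil B (a *: v) w = a * bil B v w.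
Proof. by rewrite /bil linearZ /= -!scalemxAl mxE. Qed.
Lemma bilZr a v w : bil B v (a *: w) = a * bil B v w.
Proof. by rewrite /bil -scalemxAr mxE. Qed.
Lemma bilNl v w : bil B (- v) w = - bil B v w.
Proof. by rewrite -scaleN1r bilZl mulN1r. Qed.
Lemma bilNr v w : bil B v (- w) = - bil B v w.
Proof. by rewrite -scaleN1r bilZr mulN1r. Qed.
Lemma bilBl u v w : bil B (u - v) w = bil B u w - bil B v w.
Proof. by rewrite bilDl bilNl. Qed.
Lemma bilBr u v w : bil B u (v - w) = bil B u v - bil B u w.
Proof. by rewrite bilDr bilNr. Qed.

Lemma bil_sim g mu v w : similitude B g mu ->
  bil B (g *m v) (g *m w) = mu * bil B v w.
Proof.
move=> sg; rewrite /bil trmx_mul.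
have -> : v^T *m g^T *m B *m (g *m w) = v^T *m (g^T *m B *m g) *m w.
  by rewrite !mulmxA.
by rewrite sg -scalemxAr -scalemxAl mxE.
Qed.

Lemma sim1 : similitude B 1%:M 1.
Proof. by rewrite /similitude trmx1 mul1mx mulmx1 scale1r. Qed.

Lemma simM g h mu nu :
  similitude B g mu -> similitude B h nu -> similitude B (g *m h) (mu * nu).
Proof.
move=> sg sh; rewrite /similitude trmx_mul.
have -> : h^T *m g^T *m B *m (g *m h) = h^T *m (g^T *m B *m g) *m h.
  by rewrite !mulmxA.
by rewrite sg -scalemxAr -scalemxAl sh scalerA.
Qed.

Lemma simZ a g mu : similitude B g mu -> similitude B (a *: g) (a ^+ 2 * mu).
Proof.
move=> sg; rewrite /similitude [(a *: g)^T]linearZ /= -!scalemxAl -scalemxAr sg.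
by rewrite !scalerA expr2.
Qed.

Hypothesis symB : B^T = B.

Lemma bilC v w : bil B v w = bil B w v.
Proof.
have tr11 (M : 'M[R]_1) : M 0 0 = M^T 0 0 by rewrite mxE.
by rewrite /bil tr11 !trmx_mul trmxK symB mulmxA.
Qed.

Lemma scaled_reflection_sqr v :
  scaled_reflection B v *m scaled_reflection B v = (bil B v v ^+ 2)%:M.
Proof.
rewrite {1 2}/scaled_reflection.
set b := bil B v v; set M := v *m v^T *m B.
have MM : M *m M = b *: M.
  rewrite /M; have -> : v *m v^T *m B *m (v *m v^T *m B) =
    v *m (v^T *m B *m v) *m v^T *m B by rewrite !mulmxA.
  by rewrite bilE mul_mx_scalar -!scalemxAl.
rewrite mulmxBl !mulmxBr -!scalemxAl -!scalemxAr MM !mul1mx mulmx1.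
rewrite -scalemx1; apply/matrixP => i j; rewrite !mxE; ring.
Qed.

Lemma scaled_reflection_sim v :
  similitude B (scaled_reflection B v) (bil B v v ^+ 2).
Proof.
have SB : (scaled_reflection B v)^T *m B = B *m scaled_reflection B v.
  rewrite [X in X *m _]linearB /= [X in X - _]linearZ [X in _ - X]linearZ /= trmx1.
  rewrite mulmxBl mulmxBr -!scalemxAl -!scalemxAr mul1mx mulmx1.
  by rewrite !trmx_mul trmxK symB !mulmxA.
by rewrite /similitude SB -mulmxA scaled_reflection_sqr mul_mx_scalar.
Qed.

Lemma scaled_reflectionE v w :
  scaled_reflection B v *m w = bil B v v *: w - (2 * bil B v w) *: v.
Proof.
rewrite /scaled_reflection mulmxBl -!scalemxAl mul1mx -!mulmxA.
by rewrite [v^T *m _]mulmxA bilE mul_mx_scalar scalerA.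
Qed.

End Bil.

Lemma congruenceM2 (R : comNzRingType) n r s t (B : 'M[R]_n) (g : 'M[R]_(n, r))
    (X : 'M[R]_(r, s)) (Y : 'M[R]_(r, t)) :
  (g *m X)^T *m B *m (g *m Y) = X^T *m (g^T *m B *m g) *m Y.
Proof. by rewrite trmx_mul !mulmxA. Qed.

Lemma congruenceM (R : comNzRingType) n r s (B : 'M[R]_n) (g : 'M[R]_(n, r))
    (X : 'M[R]_(r, s)) :
  (g *m X)^T *m B *m (g *m X) = X^T *m (g^T *m B *m g) *m X.
Proof. exact: congruenceM2. Qed.

Lemma similitude_scale (R : comNzRingType) n (B k : 'M[R]_n) a lam :
  similitude B k lam -> similitude (a *: B) k lam.
Proof.
by rewrite /similitude -scalemxAr -scalemxAl => ->; rewrite !scalerA mulrC.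
Qed.

Lemma similitude_block (R : comNzRingType) r s (B1 k1 : 'M[R]_r) (B2 k2 : 'M[R]_s) lam :
  similitude B1 k1 lam -> similitude B2 k2 lam ->
  similitude (block_mx B1 0 0 B2) (block_mx k1 0 0 k2) lam.
Proof.
move=> s1 s2; rewrite /similitude tr_block_mx !trmx0 !mulmx_block.
by rewrite !(mulmx0, mul0mx, addr0, add0r) s1 s2 scale_block_mx !scaler0.
Qed.

Lemma unitmx_neq0 (F : fieldType) n (A : 'M[F]_n) : (0 < n)%N ->
  A \in unitmx -> A != 0.
Proof.
move=> n0; apply: contraTneq => ->.
have -> : (0 : 'M[F]_n) = 0%:M by rewrite raddf0.
by rewrite unitmxE det_scalar expr0n gtn_eqF // unitr0.
Qed.

Lemma unitmx_diag (F : fieldType) r (c : 'rV[F]_r) :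
  (forall j, c 0 j != 0) -> diag_mx c \in unitmx.
Proof.
move=> c0; rewrite unitmxE det_diag unitfE prodf_seq_neq0; apply/allP => j _.
exact: c0.
Qed.

(** Both sides are the determinant of the block matrix with rows (1, -u) and
(w, 1), which unipotent matrices reduce to either side. *)
Lemma det_1Drank1 (R : comNzRingType) n (u : 'cV[R]_n) (w : 'rV[R]_n) :
  \det (1%:M + u *m w) = 1 + (w *m u) 0 0.
Proof.
have e1 : block_mx 1%:M (- u) w (1%:M : 'M_1) *m block_mx 1%:M u 0 1%:M =
          block_mx 1%:M 0 w (1%:M + w *m u).
  by rewrite mulmx_block ?(mulmx1, mul1mx, mulmx0, mulNmx, addr0, subrr) addrC.
have e2 : block_mx 1%:M (- u) w (1%:M : 'M_1) *m block_mx 1%:M 0 (- w) 1%:M =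
          block_mx (1%:M + u *m w) (- u) 0 1%:M.
  by rewrite mulmx_block ?(mulmx1, mul1mx, mulmx0, mulNmx, mulmxN, opprK, addr0, add0r, subrr).
have := congr1 determinant e1; have := congr1 determinant e2.
rewrite !det_mulmx !det_ublock !det_lblock !det1 !mul1r !mulr1 => -> ->.
by rewrite [X in \det X]mx11_scalar det_scalar1 !mxE eqxx mulr1n.
Qed.

Lemma map_bil (R S : comNzRingType) (f : {rmorphism R -> S}) n (B : 'M[R]_n) v w :
  f (bil B v w) = bil (map_mx f B) (map_mx f v) (map_mx f w).
Proof. by rewrite /bil map_trmx -!map_mxM [RHS]mxE. Qed.

Lemma map_scaled_reflection (R S : comNzRingType) (f : {rmorphism R -> S}) n
    (B : 'M[R]_n) v :
  map_mx f (scaled_reflection B v) =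
  scaled_reflection (map_mx f B) (map_mx f v).
Proof.
by rewrite /scaled_reflection map_mxB !map_mxZ map_mx1 !map_mxM -map_trmx
  map_bil rmorph_nat.
Qed.

Lemma map_similitude (R S : comNzRingType) (f : {rmorphism R -> S}) n
    (B g : 'M[R]_n) mu :
  similitude B g mu -> similitude (map_mx f B) (map_mx f g) (f mu).
Proof. by rewrite /similitude map_trmx -!map_mxM => ->; rewrite map_mxZ. Qed.

Section Field.
Variables (F : fieldType) (n : nat) (B : 'M[F]_n).
Hypothesis two_neq0 : 2 != 0 :> F.
Hypothesis symB : B^T = B.
Implicit Types (u v w : 'cV[F]_n).

Definition reflection v : 'M[F]_n := (bil B v v)^-1 *: scaled_reflection B v.

Lemma reflection_sim v : bil B v v != 0 -> similitude B (reflection v) 1.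
Proof.
move=> v0; have := simZ (bil B v v)^-1 (scaled_reflection_sim symB v).
by rewrite -exprMn mulVf // expr1n.
Qed.

Lemma det_reflection v : bil B v v != 0 -> \det (reflection v) = -1.
Proof.
move=> v0; have -> : reflection v = 1%:M + ((- 2 / bil B v v) *: v) *m (v^T *m B).
  rewrite /reflection /scaled_reflection scalerBr !scalerA mulVf // scale1r.
  by rewrite -scalemxAl mulmxA [X in _ = _ + X *: _]mulNr scaleNr [2 / _]mulrC.
rewrite det_1Drank1 -scalemxAr mxE -/(bil B v v).
by rewrite mulfVK //; ring.
Qed.

Lemma reflectionE v w :
  reflection v *m w = (bil B v v)^-1 *: (bil B v v *: w - (2 * bil B v w) *: v).
Proof. by rewrite /reflection -scalemxAl scaled_reflectionE. Qed.

Lemma reflection_sqr v : bil B v v != 0 -> reflection v *m reflection v = 1%:M.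
Proof.
move=> v0; rewrite /reflection -scalemxAl -scalemxAr scaled_reflection_sqr.
rewrite !scale_scalar_mx; congr (_%:M); by field.
Qed.

Lemma reflection_fix v w : bil B v v != 0 -> bil B v w = 0 ->
  reflection v *m w = w.
Proof. by move=> v0 vw; rewrite reflectionE vw mulr0 scale0r subr0 scalerA mulVf // scale1r. Qed.

Lemma reflection_swap v w : bil B v v = bil B w w -> bil B (v - w) (v - w) != 0 ->
  reflection (v - w) *m v = w.
Proof.
move=> vw nz; rewrite reflectionE.
have -> : 2 * bil B (v - w) v = bil B (v - w) (v - w).
  by rewrite !(bilBl, bilBr) -vw [bil B w v](bilC symB); ring.
by rewrite -scalerBr scalerA mulVf // scale1r subKr.
Qed.

Lemma reflection_opp v : bil B v v != 0 -> reflection v *m (- v) = v.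
Proof.
move=> v0; rewrite reflectionE bilNr mulrN scaleNr opprK scalerN -scaleNr.
by rewrite -scalerDl scalerA -[RHS]scale1r; congr (_ *: _); field.
Qed.

(** The boolean is the parity of the number of reflections; it determines the
determinant of the product. *)
Inductive reflection_product : bool -> 'M[F]_n -> Prop :=
| reflection_product_nil : reflection_product false 1%:M
| reflection_product_cons b v s : bil B v v != 0 -> reflection_product b s ->
    reflection_product (~~ b) (reflection v *m s).

Lemma reflection_product_sim b s : reflection_product b s -> similitude B s 1.
Proof.
elim=> [|{}b v {}s v0 _ IH]; first exact: sim1.
by rewrite -[1]mulr1; apply: simM => //; apply: reflection_sim.
Qed.

Lemma det_reflection_product b s : reflection_product b s -> \det s = (-1) ^+ b.
Proof.
elim=> [|{}b v {}s v0 _ IH]; first exact: det1.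
by rewrite det_mulmx IH det_reflection // mulN1r -signrN.
Qed.

(** The reflections are chosen column by column. Let f be a column of Y and e
the current image of the corresponding column of X. They have the same length,
and e - f or e + f is anisotropic because the lengths of these two vectors add
up to four times that of f. The reflection in e - f, or else the reflection in
e + f followed by that in f, takes e to f. It fixes the columns of Y that were
treated before, since they are orthogonal to e and to f. *)
Lemma witt_extension r (X Y : 'M[F]_(n, r)) (c : 'rV[F]_r) :
    X^T *m B *m X = diag_mx c -> Y^T *m B *m Y = diag_mx c ->
    (forall j, c 0 j != 0) ->
  exists b s, reflection_product b s /\ s *m X = Y.
Proof.
move=> XX YY c0.
have bY i j : bil B (col i Y) (col j Y) = c 0 i *+ (i == j).
  by rewrite -bil_col YY mxE.
have bX i j : bil B (col i X) (col j X) = c 0 i *+ (i == j).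
  by rewrite -bil_col XX mxE.
suff /(_ r) [b [s [ps sXY]]] : forall k, exists b s, reflection_product b s /\
    forall i : 'I_r, (i < k)%N -> s *m col i X = col i Y.
  exists b, s; split=> //; apply/matrixP => i j.
  by have /matrixP /(_ i 0) := sXY j (ltn_ord j); rewrite colE mulmxA -colE !mxE.
elim=> [|k [b [s [ps IH]]]]; first by exists false, 1%:M; split=> //; exact: reflection_product_nil.
have [rk|kr] := leqP r k.
  by exists b, s; split=> // i _; apply: IH; apply: leq_trans (ltn_ord i) rk.
have ss : similitude B s 1 by apply: reflection_product_sim ps.
pose i0 := Ordinal kr; pose e := s *m col i0 X; pose f := col i0 Y.
have ee : bil B e e = bil B f f by rewrite (bil_sim _ _ ss) mul1r bX bY.
have f0 : bil B f f != 0 by rewrite bY eqxx; apply: c0.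
have eY (i : 'I_r) : (i < k)%N -> bil B e (col i Y) = 0.
  move=> ik; rewrite -(IH i ik) (bil_sim _ _ ss) bX.
  by rewrite -val_eqE /= gtn_eqF // mul1r mulr0n.
have fY (i : 'I_r) : (i < k)%N -> bil B f (col i Y) = 0.
  by move=> ik; rewrite bY -val_eqE /= gtn_eqF.
have case_lt (i : 'I_r) : (i < k.+1)%N -> (i < k)%N \/ i = i0.
  rewrite ltnS leq_eqVlt => /orP[/eqP ik|]; [right; exact: val_inj|by left].
have [z|nz] := eqVneq (bil B (e - f) (e - f)) 0; last first.
  exists (~~ b), (reflection (e - f) *m s); split; first exact: reflection_product_cons.
  move=> i /case_lt[ik|->]; rewrite -mulmxA; last exact: reflection_swap.
  by rewrite IH // reflection_fix // bilBl eY // fY // subr0.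
have nz : bil B (e + f) (e + f) != 0.
  have : bil B (e + f) (e + f) + bil B (e - f) (e - f) = 2 * (2 * bil B f f).
    by rewrite !(bilBl, bilBr, bilDl, bilDr) ee; ring.
  by rewrite z addr0 => ->; rewrite !mulf_neq0.
exists (~~ ~~ b), (reflection f *m (reflection (e + f) *m s)); split.
  by do 2!apply: reflection_product_cons => //.
move=> i /case_lt[ik|->].
  rewrite -!mulmxA IH // (reflection_fix nz) ?bilDl ?eY ?fY ?addr0 //.
  by apply: reflection_fix => //; apply: fY.
have swap : reflection (e + f) *m e = - f.
  rewrite -[f in e + f]opprK; apply: reflection_swap; last by rewrite opprK.
  by rewrite bilNl bilNr opprK.
by rewrite -!mulmxA -/e swap; apply: reflection_opp.
Qed.

Lemma cartan_dieudonne (Q : 'M[F]_n) (c : 'rV[F]_n) g :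
    Q \in unitmx -> Q^T *m B *m Q = diag_mx c -> (forall j, c 0 j != 0) ->
    similitude B g 1 ->
  exists b, reflection_product b g.
Proof.
move=> uQ QQ c0 sg.
have gQ : (g *m Q)^T *m B *m (g *m Q) = diag_mx c.
  by rewrite congruenceM sg scale1r.
have [b [s [ps sQ]]] := witt_extension QQ gQ c0.
exists b; suff -> : g = s by [].
by rewrite -[g](mulmxK uQ) -sQ mulmxK.
Qed.
End Field.

(** * Polynomial paths of similitudes *)

Notation evmx a := (map_mx (horner_eval a)).

Lemma evmxC (F : fieldType) (a : F) m n (A : 'M[F]_(m, n)) :
  evmx a (map_mx polyC A) = A.
Proof. by apply/matrixP => i j; rewrite !mxE /horner_eval hornerC. Qed.

(** A rational curve from the class of 1 to that of g in the projective
similitudes: there H counts up to scalars, hence the factors c and c'. *)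
Definition polynomial_path (F : fieldType) (n : nat) (B g : 'M[F]_n) : Prop :=
  exists (H : 'M[{poly F}]_n) (nu : {poly F}) (c c' : F),
    [/\ similitude (map_mx polyC B) H nu, c != 0, c' != 0,
        evmx 0 H = c%:M & evmx 1 H = c' *: g].

Section Path.
Variables (F : fieldType) (n : nat) (B : 'M[F]_n).

Lemma polynomial_path1 : polynomial_path B 1%:M.
Proof.
exists 1%:M, 1, 1, 1; split; rewrite ?oner_neq0 ?map_mx1 ?scale1r //.
exact: sim1.
Qed.

Lemma polynomial_pathM g h :
  polynomial_path B g -> polynomial_path B h -> polynomial_path B (g *m h).
Proof.
move=> [G [mu [c [c' [sG c0 c'0 G0 G1]]]]] [H [nu [e [e' [sH e0 e'0 H0 H1]]]]].
exists (G *m H), (mu * nu), (c * e), (c' * e'); split; rewrite ?mulf_neq0 //.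
- exact: simM.
- by rewrite map_mxM G0 H0 scalar_mxM.
- by rewrite map_mxM G1 H1 -scalemxAl -scalemxAr scalerA.
Qed.

Hypothesis two_neq0 : 2 != 0 :> F.
Hypothesis symB : B^T = B.

(** The vector v moves linearly to w, where the product becomes a scalar. The
line may cross isotropic vectors, but not at its ends. *)
Lemma path_reflection_pair v w : bil B v v != 0 -> bil B w w != 0 ->
  polynomial_path B (reflection B v *m reflection B w).
Proof.
move=> v0 w0.
pose vt := (1 - 'X) *: map_mx polyC w + 'X *: map_mx polyC v.
exists (scaled_reflection (map_mx polyC B) vt *m
        scaled_reflection (map_mx polyC B) (map_mx polyC w)).
have symP : (map_mx polyC B)^T = map_mx polyC B by rewrite map_trmx symB.
have vt0 : evmx 0 vt = w.
  apply/matrixP => i j; rewrite !mxE /horner_eval !hornerE; ring.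
have vt1 : evmx 1 vt = v.
  apply/matrixP => i j; rewrite !mxE /horner_eval !hornerE; ring.
exists (bil (map_mx polyC B) vt vt ^+ 2 *
        bil (map_mx polyC B) (map_mx polyC w) (map_mx polyC w) ^+ 2).
exists (bil B w w ^+ 2), (bil B v v * bil B w w).
split; rewrite ?mulf_neq0 ?expf_neq0 //.
- by apply: simM; apply: scaled_reflection_sim.
- by rewrite map_mxM !map_scaled_reflection !evmxC vt0 scaled_reflection_sqr.
- rewrite map_mxM !map_scaled_reflection !evmxC vt1 /reflection.
  rewrite -scalemxAl -scalemxAr !scalerA.
  by rewrite [X in X *: _](_ : _ = 1) ?scale1r //; field; rewrite v0 w0.
Qed.

(** An odd product is completed by a fixed reflection, so that the reflections
can be taken in pairs. *)
Lemma path_reflection_product v0 b s : bil B v0 v0 != 0 ->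
  reflection_product B b s ->
  polynomial_path B (if b then reflection B v0 *m s else s).
Proof.
move=> nz; elim=> [|{}b v {}s vnz _ IH]; first exact: polynomial_path1.
case: b IH => /= IH.
  have -> : reflection B v *m s =
      (reflection B v *m reflection B v0) *m (reflection B v0 *m s).
    by rewrite -mulmxA (mulmxA (reflection B v0)) reflection_sqr // mul1mx.
  by apply: polynomial_pathM => //; apply: path_reflection_pair.
by rewrite mulmxA; apply: polynomial_pathM => //; apply: path_reflection_pair.
Qed.

Lemma path_isometry (Q : 'M[F]_n) (c : 'rV[F]_n) g :
    Q \in unitmx -> Q^T *m B *m Q = diag_mx c -> (forall j, c 0 j != 0) ->
    similitude B g 1 -> \det g = 1 ->
  polynomial_path B g.
Proof.
move=> uQ QQ c0 sg dg.
have [b pg] := cartan_dieudonne two_neq0 symB uQ QQ c0 sg.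
have := det_reflection_product pg; rewrite dg.
case: b pg => [_ /eqP|pg _].
  by rewrite expr1 -addr_eq0 (negPf two_neq0).
have [n0|n_gt0] := posnP n.
  have -> : g = 1%:M; last exact: polynomial_path1.
  by apply/matrixP => i; have := ltn_ord i; rewrite [X in (_ < X)%N]n0.
apply: (path_reflection_product (v0 := col (Ordinal n_gt0) Q)) pg.
by rewrite -bil_col QQ mxE eqxx; apply: c0.
Qed.
End Path.

(** * Polynomial families of quaternions with a common reduced norm *)

(** The norm of r + s sqrt d. *)
Definition qnorm (R : comNzRingType) (d r s : R) : R := r ^+ 2 - d * s ^+ 2.

(** Let z = u + j and z' = v + j' be quaternions of reduced norm l in the
algebras (d, x) and (d, y), so that x = N u - l and y = N v - l, and let
w = p + t z + t z' in the tensor product of R[z] and R[z']. The norm of w to R[z] is A + C z, its norm to R[z'] is A' + C z', and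
the norms of these to R are both the norm of w. *)
Lemma common_norm2 (R : comNzRingType) (d l p t u0 u1 v0 v1 : R) :
  let C := t * (2 * p + 2 * t * (u0 + v0)) in
  let A := p * (p + 2 * t * v0) in
  let A' := p * (p + 2 * t * u0) in
  qnorm d (A + C * u0) (C * u1) - (qnorm d u0 u1 - l) * C ^+ 2 =
  qnorm d (A' + C * v0) (C * v1) - (qnorm d v0 v1 - l) * C ^+ 2.
Proof. rewrite /qnorm /=; ring. Qed.

(** The tensor product of (d, x) and (d, y) is the algebra of 2 by 2 matrices
over (d, x y), with sqrt d in both factors identified by an idempotent. The
diagonal entries of w = p + t z + t z' are p + t (u + v) and p + t (u + v'),
with v' the conjugate of v; the latter is D and has norm N.
Multiplied by N, the Schur complement is Y + S k with k^2 = x y, so its reduced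
norm is N times that of w. *)
Lemma common_norm3 (R : comNzRingType) (d l p t u0 u1 v0 v1 : R) :
  let C := t * (2 * p + 2 * t * (u0 + v0)) in
  let A := p * (p + 2 * t * v0) in
  let x := qnorm d u0 u1 - l in
  let y := qnorm d v0 v1 - l in
  let D0 := p + t * (u0 + v0) in
  let D1 := t * (u1 - v1) in
  let N := qnorm d D0 D1 in
  let Y0 := D0 * N - t ^+ 2 * (x + y) * D0 in
  let Y1 := t * (u1 + v1) * N - t ^+ 2 * (x - y) * D1 in
  let S := - 2 * t ^+ 2 * D0 in
  qnorm d Y0 Y1 - x * y * S ^+ 2 =
  N * (qnorm d (A + C * u0) (C * u1) - x * C ^+ 2).
Proof. rewrite /qnorm /=; ring. Qed.

Lemma horner1 (R : nzRingType) (a : R) : (1 : {poly R}).[a] = 1.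
Proof. exact: hornerC. Qed.

Definition horner_eval_rules := (hornerD, hornerN, hornerX, hornerMn, hornerC,
  horner1, horner_exp, hornerM).

Section NormPaths.
Variables (F : fieldType) (d : F).

(** The reduced norms nu of the polynomial curves that start at 1 in the
quaternion algebra (d, x). *)
Definition norm_path (x : F) (nu : {poly F}) : Prop :=
  exists p0 p1 r0 r1 : {poly F},
    [/\ nu = qnorm d%:P p0 p1 - x%:P * qnorm d%:P r0 r1,
        p0.[0] = 1, p1.[0] = 0, r0.[0] = 0 & r1.[0] = 0].

Lemma qnormC (r s : F) : (qnorm d r s)%:P = qnorm d%:P r%:P s%:P.
Proof. by rewrite /qnorm polyCB [(d * _)%:P]polyCM !polyC_exp. Qed.

Lemma horner_qnorm (p q : {poly F}) a :
  (qnorm d%:P p q).[a] = qnorm d p.[a] q.[a].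
Proof. by rewrite /qnorm !horner_eval_rules. Qed.

(** The quaternion z = u1 sqrt d + j has trace 0, so the reduced norm of the
segment from 1 to z depends only on the reduced norm l of z. *)
Lemma norm_path_linear x l u1 : l = qnorm d 0 u1 - x ->
  norm_path x ((1 - 'X) ^+ 2 + l%:P * 'X ^+ 2).
Proof.
move=> ->; exists (1 - 'X), ('X * u1%:P), 'X, 0.
rewrite polyCB qnormC polyC0; split; try by rewrite !horner_eval_rules; ring.
by rewrite /qnorm; ring.
Qed.

(** At t = 1 the partial norms of [common_norm2] are the given quaternions
multiplied by the sum of their traces, which therefore must not vanish. *)
Lemma norm_path_common x y l u0 u1 v0 v1 :
    l = qnorm d u0 u1 - x -> l = qnorm d v0 v1 - y ->
    2 * (u0 + v0) != 0 ->
  exists nu c, [/\ c != 0, nu.[1] = l * c ^+ 2,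
    norm_path x nu & norm_path y nu].
Proof.
move=> lx ly nz.
have ex : x = qnorm d u0 u1 - l by rewrite lx; ring.
have ey : y = qnorm d v0 v1 - l by rewrite ly; ring.
have := @common_norm2 _ d%:P l%:P (1 - 'X) 'X u0%:P u1%:P v0%:P v1%:P.
rewrite -!qnormC -!polyCB -ex -ey /=.
set C := 'X * (2 * _ + _); set A := (1 - 'X) * _; set A' := (1 - 'X) * _ => E.
exists (qnorm d%:P (A + C * u0%:P) (C * u1%:P) - x%:P * C ^+ 2), (2 * (u0 + v0)).
split=> //.
- rewrite /A /C lx /qnorm !horner_eval_rules; ring.
- exists (A + C * u0%:P), (C * u1%:P), C, 0.
  by split; first (by rewrite /qnorm; ring);
    by rewrite /A /C !horner_eval_rules; ring.
- exists (A' + C * v0%:P), (C * v1%:P), C, 0.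
  by rewrite E; split; first (by rewrite /qnorm; ring);
    by rewrite /A' /C !horner_eval_rules; ring.
Qed.

(** The curves of [norm_path_common], multiplied by N, have the same reduced norm
as D (Y + S k) in the third algebra, where D and N are those of [common_norm3].
At t = 1 the first coordinate of D is u0 + v0, and N does not vanish because d is
not a square. *)
Lemma norm_path_common3 x y z l u0 u1 v0 v1 f0 f1 :
    (forall r, d != r ^+ 2) ->
    l = qnorm d u0 u1 - x -> l = qnorm d v0 v1 - y ->
    x * y = z * qnorm d f0 f1 ->
    2 * (u0 + v0) != 0 ->
  exists nu c, [/\ c != 0, nu.[1] = l * c ^+ 2,
    norm_path x nu, norm_path y nu & norm_path z nu].
Proof.
move=> d_nsq lx ly exyz nz.
have ex : x = qnorm d u0 u1 - l by rewrite lx; ring.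
have ey : y = qnorm d v0 v1 - l by rewrite ly; ring.
have := @common_norm2 _ d%:P l%:P (1 - 'X) 'X u0%:P u1%:P v0%:P v1%:P.
have := @common_norm3 _ d%:P l%:P (1 - 'X) 'X u0%:P u1%:P v0%:P v1%:P.
rewrite -!qnormC -!polyCB -ex -ey /=.
set C := 'X * (2 * _ + _); set A := (1 - 'X) * _; set A' := (1 - 'X) * _.
set D0 := 1 - 'X + _; set D1 := 'X * (_ - _)%:P; set N := qnorm _ D0 _.
set Y0 := D0 * _ - _; set Y1 := _ * N - _; set S := - 2 * _ * D0.
move=> E3 E2.
have N1 : N.[1] != 0.
  rewrite horner_qnorm (_ : D0.[1] = u0 + v0); last by rewrite /D0 !horner_eval_rules; ring.
  have w0 : u0 + v0 != 0 by apply: contraNneq nz => ->; rewrite mulr0.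
  rewrite /qnorm; set w := u0 + v0 in w0 *; set e := _.[1].
  have [e0|e0] := eqVneq e 0.
    by rewrite e0 expr0n mulr0 subr0 expf_neq0.
  apply: contraNneq (d_nsq (w / e)) => /eqP; rewrite subr_eq0 => /eqP we.
  by rewrite expr_div_n we mulfK // expf_neq0.
exists (N ^+ 2 * (qnorm d%:P (A + C * u0%:P) (C * u1%:P) - x%:P * C ^+ 2)).
exists (N.[1] * (2 * (u0 + v0))); split.
- by rewrite mulf_neq0.
- rewrite /N /A /C /D0 /D1 lx /qnorm !horner_eval_rules; ring.
- exists (N * (A + C * u0%:P)), (N * (C * u1%:P)), (N * C), 0.
  split; first (by rewrite /qnorm; ring);
    by rewrite /N /qnorm /A /C /D0 /D1 !horner_eval_rules; ring.
- exists (N * (A' + C * v0%:P)), (N * (C * v1%:P)), (N * C), 0.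
  rewrite E2; split; first (by rewrite /qnorm; ring);
    by rewrite /N /qnorm /A' /C /D0 /D1 !horner_eval_rules; ring.
- exists (D0 * Y0 + d%:P * D1 * Y1), (D0 * Y1 + D1 * Y0),
    (S * (D0 * f0%:P + d%:P * D1 * f1%:P)), (S * (D0 * f1%:P + D1 * f0%:P)).
  split.
  + rewrite expr2 -mulrA -E3 -polyCM exyz polyCM qnormC /N /qnorm; ring.
  + rewrite /Y0 /N /qnorm /D0 /D1 !horner_eval_rules; ring.
  + rewrite /Y0 /Y1 /N /qnorm /D0 /D1 !horner_eval_rules; ring.
  + rewrite /S !horner_eval_rules; ring.
  + rewrite /S !horner_eval_rules; ring.
Qed.
End NormPaths.

Section Blocks.
Variables (F : fieldType) (d : F).
Hypothesis two_neq0 : 2 != 0 :> F.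

(** Replacing a quaternion by its opposite changes the sign of its trace and
keeps its reduced norm. *)
Lemma sign_choice u0 v0 : (u0 != 0) || (v0 != 0) ->
  exists e : F, e ^+ 2 = 1 /\ 2 * (u0 + e * v0) != 0.
Proof.
move=> uv; have [s0|s0] := eqVneq (u0 + v0) 0; last first.
  by exists 1; rewrite expr1n mul1r mulf_neq0.
exists (-1); rewrite sqrrN expr1n; split=> //.
apply: contraTneq uv => /eqP; rewrite mulN1r mulf_eq0 (negPf two_neq0) /= subr_eq0.
move=> /eqP e; move: s0; rewrite e => /eqP.
by rewrite -mulr2n -mulr_natl mulf_eq0 (negPf two_neq0) /= => ->.
Qed.

Lemma qnorm_sign e v0 v1 : e ^+ 2 = 1 -> qnorm d v0 v1 = qnorm d (e * v0) (e * v1).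
Proof. by move=> e1; rewrite /qnorm !exprMn e1 !mul1r. Qed.

Lemma norm_path_linear1 (l : F) : ((1 - 'X) ^+ 2 + l%:P * 'X ^+ 2).[1] = l * 1 ^+ 2.
Proof. by rewrite !horner_eval_rules; ring. Qed.

(** If one of the traces is nonzero, [norm_path_common] applies after a change of
sign; otherwise the two segments from 1 have the same reduced norms. *)
Lemma norm_paths2 x y l u0 u1 v0 v1 :
    l = qnorm d u0 u1 - x -> l = qnorm d v0 v1 - y ->
  exists nu c, [/\ c != 0, nu.[1] = l * c ^+ 2, norm_path d x nu & norm_path d y nu].
Proof.
move=> lx ly; have [uv|] := boolP ((u0 != 0) || (v0 != 0)).
  have [e [e1 nz]] := sign_choice uv; rewrite (qnorm_sign v0 v1 e1) in ly.
  exact: norm_path_common lx ly nz.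
rewrite negb_or !negbK => /andP[/eqP u00 /eqP v00]; subst u0 v0.
exists ((1 - 'X) ^+ 2 + l%:P * 'X ^+ 2), 1.
by rewrite oner_neq0 norm_path_linear1; split=> //;
  [apply: norm_path_linear lx | apply: norm_path_linear ly].
Qed.

(** The hypothesis on x y z is symmetric, so any block with nonzero trace can be
put first. *)
Lemma norm_paths3 x y z l u0 u1 v0 v1 w0 w1 f0 f1 :
    (forall r, d != r ^+ 2) -> x != 0 -> y != 0 -> z != 0 ->
    l = qnorm d u0 u1 - x -> l = qnorm d v0 v1 - y -> l = qnorm d w0 w1 - z ->
    x * y * z = qnorm d f0 f1 ->
  exists nu c, [/\ c != 0, nu.[1] = l * c ^+ 2,
    norm_path d x nu, norm_path d y nu & norm_path d z nu].
Proof.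
move=> dns.
have key x' y' z' s0 s1 t0 t1 : z' != 0 ->
    l = qnorm d s0 s1 - x' -> l = qnorm d t0 t1 - y' ->
    x' * y' * z' = qnorm d f0 f1 -> (s0 != 0) || (t0 != 0) ->
  exists nu c, [/\ c != 0, nu.[1] = l * c ^+ 2,
    norm_path d x' nu, norm_path d y' nu & norm_path d z' nu].
  move=> z0 lx ly xyz st; have [e [e1 nz]] := sign_choice st.
  rewrite (qnorm_sign t0 t1 e1) in ly.
  apply: (norm_path_common3 (f0 := f0 / z') (f1 := f1 / z')) lx ly _ nz => //.
  have -> : qnorm d (f0 / z') (f1 / z') = qnorm d f0 f1 / z' ^+ 2.
    by rewrite /qnorm; field.
  by rewrite -xyz; field.
move=> x0 y0 z0 lx ly lz xyz.
have [uv|] := boolP ((u0 != 0) || (v0 != 0)).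
  exact: key z0 lx ly xyz uv.
rewrite negb_or !negbK => /andP[/eqP u00 /eqP v00].
have [w00|wn0] := eqVneq w0 0; last first.
  have wu : (w0 != 0) || (u0 != 0) by rewrite wn0.
  have [|nu [c [c0 e Pz Px Py]]] := key _ _ _ _ _ _ _ y0 lz lx _ wu.
    by rewrite -xyz; ring.
  by exists nu, c.
subst u0 v0 w0; exists ((1 - 'X) ^+ 2 + l%:P * 'X ^+ 2), 1.
rewrite oner_neq0 norm_path_linear1; split=> //; apply: norm_path_linear.
- exact: lx.
- exact: ly.
- exact: lz.
Qed.
End Blocks.

(** The reduced norm of the quaternion algebra (d, x), in the basis 1, sqrt d, j,
sqrt d j. *)
Definition block_form (R : comNzRingType) (d x : R) : 'rV[R]_4 :=
  \row_j nth 0 [:: 1; - d; - x; d * x] j.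

(** Right multiplication by p0 + p1 sqrt d + (r0 + r1 sqrt d) j. *)
Definition block_mult (R : comNzRingType) (d x p0 p1 r0 r1 : R) : 'M[R]_4 :=
  \matrix_(i, j) nth 0 (nth [::]
    [:: [:: p0; d * p1; x * r0; - (d * x * r1)];
        [:: p1; p0; - (x * r1); x * r0];
        [:: r0; d * r1; p0; - (d * p1)];
        [:: r1; r0; - p1; p0]] i) j.

Lemma block_mult_sim (R : comNzRingType) (d x p0 p1 r0 r1 : R) :
  similitude (diag_mx (block_form d x)) (block_mult d x p0 p1 r0 r1)
    (qnorm d p0 p1 - x * qnorm d r0 r1).
Proof.
rewrite /similitude mul_mx_diag; apply/matrixP => i j.
rewrite !mxE !big_ord_recl big_ord0 !mxE /qnorm.
case: i => [[|[|[|[|//]]]] ?]; case: j => [[|[|[|[|//]]]] ?] /=;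
  rewrite ?mulr1n ?mulr0n; ring.
Qed.

Lemma block_mult1 (R : comNzRingType) (d x : R) : block_mult d x 1 0 0 0 = 1%:M.
Proof.
apply/matrixP => i j; rewrite !mxE.
case: i => [[|[|[|[|//]]]] ?]; case: j => [[|[|[|[|//]]]] ?] /=;
  rewrite ?mulr0 ?oppr0 //.
Qed.

Lemma map_block_mult (R S : comNzRingType) (f : {rmorphism R -> S}) (d x p0 p1 r0 r1 : R) :
  map_mx f (block_mult d x p0 p1 r0 r1) =
  block_mult (f d) (f x) (f p0) (f p1) (f r0) (f r1).
Proof.
apply/matrixP => i j; rewrite !mxE.
case: i => [[|[|[|[|//]]]] ?]; case: j => [[|[|[|[|//]]]] ?] /=;
  by rewrite ?rmorphN ?rmorphM.
Qed.

Definition multiplier_path (F : fieldType) n (B : 'M[F]_n) (nu : {poly F}) : Prop :=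
  exists2 M : 'M[{poly F}]_n, similitude (map_mx polyC B) M nu & evmx 0 M = 1%:M.

Section MultiplierPath.
Variable F : fieldType.

Lemma multiplier_path_block (d a x : F) nu : norm_path d x nu ->
  multiplier_path (a *: diag_mx (block_form d x)) nu.
Proof.
move=> [p0 [p1 [r0 [r1 [-> e0 e1 e2 e3]]]]].
exists (block_mult d%:P x%:P p0 p1 r0 r1); last first.
  by rewrite map_block_mult /= /horner_eval !hornerC e0 e1 e2 e3 block_mult1.
have -> : map_mx polyC (a *: diag_mx (block_form d x)) =
    a%:P *: diag_mx (block_form d%:P x%:P).
  rewrite map_mxZ; congr (_ *: _); apply/matrixP => i j; rewrite !mxE.
  case: i => [[|[|[|[|//]]]] ?]; case: j => [[|[|[|[|//]]]] ?] /=;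
    by rewrite ?rmorphMn /= ?rmorphN ?rmorphM.
exact/similitude_scale/block_mult_sim.
Qed.

Lemma multiplier_path_sum n1 n2 (B1 : 'M[F]_n1) (B2 : 'M[F]_n2) nu :
  multiplier_path B1 nu -> multiplier_path B2 nu ->
  multiplier_path (block_mx B1 0 0 B2) nu.
Proof.
move=> [M1 s1 e1] [M2 s2 e2]; exists (block_mx M1 0 0 M2); last first.
  by rewrite map_block_mx !map_mx0 e1 e2 -scalar_mx_block.
by rewrite map_block_mx !map_mx0; apply: similitude_block.
Qed.

Lemma multiplier_path_congr n (B Y : 'M[F]_n) nu : Y \in unitmx ->
  multiplier_path (Y^T *m B *m Y) nu -> multiplier_path B nu.
Proof.
move=> uY [M sM M0].
have CI : map_mx polyC Y *m map_mx polyC (invmx Y) = 1%:M.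
  by rewrite -map_mxM mulmxV // map_mx1.
exists (map_mx polyC Y *m M *m map_mx polyC (invmx Y)); last first.
  by rewrite !map_mxM !evmxC M0 mulmx1 mulmxV.
set P := map_mx polyC Y in CI *; set Q := map_mx polyC _ in CI *.
have sB : map_mx polyC B = Q^T *m (P^T *m map_mx polyC B *m P) *m Q.
  rewrite !mulmxA -trmx_mul CI trmx1 mul1mx -mulmxA CI mulmx1 //.
rewrite /similitude [in RHS]sB !trmx_mul.
have -> : Q^T *m (M^T *m P^T) *m map_mx polyC B *m (P *m M *m Q) =
   Q^T *m (M^T *m (P^T *m map_mx polyC B *m P) *m M) *m Q by rewrite !mulmxA.
have sM' : M^T *m (P^T *m map_mx polyC B *m P) *m M = nu *: (P^T *m map_mx polyC B *m P).
  by move: sM; rewrite /similitude !map_mxM map_trmx.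
by rewrite sM' -scalemxAr -scalemxAl.
Qed.
End MultiplierPath.

(** * Splitting off quaternion blocks *)

Section Orth.
Variables (F : fieldType) (n : nat) (B : 'M[F]_n).
Hypothesis two_neq0 : 2 != 0 :> F.
Hypothesis symB : B^T = B.
Hypothesis unitB : B \in unitmx.

Lemma diag_mx_inv r (c : 'rV[F]_r) : (forall j, c 0 j != 0) ->
  diag_mx c *m diag_mx (\row_j (c 0 j)^-1) = 1%:M.
Proof.
move=> c0; rewrite mulmx_diag; apply/matrixP => i j; rewrite !mxE.
by rewrite mulfV.
Qed.

(** The orthogonal complement of the columns of Q is nonzero and nondegenerate,
and 2 is invertible. *)
Lemma exists_anisotropic_orthogonal r (Q : 'M[F]_(n, r)) (c : 'rV[F]_r) :
    (r < n)%N -> Q^T *m B *m Q = diag_mx c -> (forall j, c 0 j != 0) ->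
  exists v : 'cV[F]_n, Q^T *m B *m v = 0 /\ bil B v v != 0.
Proof.
move=> rn QQ c0; pose D := diag_mx (\row_j (c 0 j)^-1).
have cD : diag_mx c *m D = 1%:M by apply: diag_mx_inv.
have DT : D^T = D by rewrite tr_diag_mx.
(* R is the orthogonal projection onto the complement of the columns of Q. *)
pose R := 1%:M - Q *m D *m Q^T *m B.
have QR : Q^T *m B *m R = 0.
  rewrite mulmxBr mulmx1 !mulmxA QQ cD.
  by rewrite mul1mx subrr.
have RR : R^T *m B *m R = B *m R.
  rewrite {1}/R [X in X *m B *m R]linearB /= trmx1 !trmx_mul DT trmxK symB !mulmxA 2!mulmxBl mul1mx.
  by rewrite -!mulmxA [Q^T *m _]mulmxA QR !mulmx0 subr0.
have : B *m R != 0.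
  apply: contraTneq rn => BR0; have R0 : R = 0 by rewrite -[R](mulKmx unitB) BR0 mulmx0.
  rewrite -leqNgt -(mxrank1 F n).
  have -> : 1%:M = Q *m (D *m Q^T *m B).
    by apply/eqP; rewrite -subr_eq0 !mulmxA -/R R0.
  exact: leq_trans (mxrankM_maxl _ _) (rank_leq_col _).
case/matrix0Pn => i [j]; rewrite -RR bil_col => nz.
have Qcol k : Q^T *m B *m col k R = 0.
  by rewrite colE mulmxA QR mul0mx.
have [zi|] := eqVneq (bil B (col i R) (col i R)) 0; last by exists (col i R).
have [zj|] := eqVneq (bil B (col j R) (col j R)) 0; last by exists (col j R).
exists (col i R + col j R); rewrite mulmxDr !Qcol addr0; split=> //.
rewrite bilDl !bilDr zi zj add0r addr0 [X in _ + X](bilC symB) -mulr2n -mulr_natl.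
by rewrite mulf_neq0.
Qed.
End Orth.

Section Semilinear.
Variables (F : fieldType) (n : nat) (B J : 'M[F]_n) (d : F).
Hypothesis two_neq0 : 2 != 0 :> F.
Hypothesis d_neq0 : d != 0.
Hypothesis symB : B^T = B.
Hypothesis unitB : B \in unitmx.
Hypothesis skewJ : J^T *m B = - (B *m J).
Hypothesis sqrJ : J *m J = d%:M.

(** Here and below J is multiplication by sqrt d. *)
Definition block_frame (v w : 'cV[F]_n) : 'M[F]_(n, 4) :=
  \matrix_(i, j) (nth 0 [:: v; J *m v; w; J *m w] j) i 0.

Lemma col_block_frame v w j :
  col j (block_frame v w) = nth 0 [:: v; J *m v; w; J *m w] j.
Proof. by apply/matrixP => i k; rewrite !mxE ord1. Qed.

Lemma bilJ v w : bil B (J *m v) w = - bil B v (J *m w).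
Proof.
rewrite /bil trmx_mul -[_ *m _ *m B]mulmxA skewJ mulmxN mulNmx mxE.
by rewrite !mulmxA.
Qed.

Lemma bilJJ v w : bil B (J *m v) (J *m w) = - d * bil B v w.
Proof. by rewrite bilJ mulmxA sqrJ mul_scalar_mx bilZr mulNr. Qed.

Lemma bilJv v : bil B v (J *m v) = 0.
Proof.
apply/eqP; have /eqP := bilJ v v; rewrite (bilC symB) -addr_eq0.
by rewrite -mulr2n -mulr_natl mulf_eq0 (negPf two_neq0).
Qed.

(** The orthogonal complement of the columns of Q is a subspace over
F[sqrt d]. *)
Definition Jstable r (Q : 'M[F]_(n, r)) := forall z : 'cV[F]_n,
  Q^T *m B *m z = 0 -> Q^T *m B *m (J *m z) = 0.

Lemma block_frame_orthP v w (z : 'cV[F]_n) :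
  (block_frame v w)^T *m B *m z = 0 <->
  [/\ bil B v z = 0, bil B v (J *m z) = 0, bil B w z = 0 & bil B w (J *m z) = 0].
Proof.
split=> [/matrixP e|[e0 e1 e2 e3]].
  have e' (j : 'I_4) : bil B (nth 0 [:: v; J *m v; w; J *m w] j) z = 0.
    by rewrite -col_block_frame; have := e j 0; rewrite bil_col col_id mxE.
  split.
  - exact: e' (@Ordinal 4 0 isT).
  - by apply/eqP; rewrite -oppr_eq0 -bilJ; apply/eqP/(e' (@Ordinal 4 1 isT)).
  - exact: e' (@Ordinal 4 2 isT).
  - by apply/eqP; rewrite -oppr_eq0 -bilJ; apply/eqP/(e' (@Ordinal 4 3 isT)).
apply/matrixP => i j; rewrite bil_col col_block_frame mxE ord1 col_id.
by case: i => [[|[|[|[|//]]]] ?] //=; rewrite bilJ (e1, e3) oppr0.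
Qed.

Lemma block_frame_stable v w : Jstable (block_frame v w).
Proof.
move=> z /block_frame_orthP[e0 e1 e2 e3]; apply/block_frame_orthP.
by rewrite !mulmxA sqrJ !mul_scalar_mx !bilZr e0 e2 !mulr0.
Qed.

Lemma block_frame_gram a x v w :
    bil B v v = a -> bil B w w = - a * x -> bil B v w = 0 -> bil B v (J *m w) = 0 ->
  (block_frame v w)^T *m B *m block_frame v w = a *: diag_mx (block_form d x).
Proof.
move=> vv ww vw vJw; apply/matrixP => i j; rewrite bil_col !col_block_frame !mxE.
have wv : bil B w v = 0 by rewrite (bilC symB).
have wJv : bil B w (J *m v) = 0 by rewrite (bilC symB) bilJ vJw oppr0.
case: i => [[|[|[|[|//]]]] ?]; case: j => [[|[|[|[|//]]]] ?] //=;
rewrite ?mulr1n ?mulr0n ?bilJJ ?bilJ ?bilJv ?vv ?ww ?vw ?wv ?vJw ?wJv; ring.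
Qed.

(** The plane of v and w over F[sqrt d] is a copy, scaled by a, of the quaternion
algebra (d, x), in which lam is the reduced norm of u + j. *)
Definition quaternion_block (lam : F) (v w : 'cV[F]_n) (a x : F) : Prop :=
  [/\ (block_frame v w)^T *m B *m block_frame v w = a *: diag_mx (block_form d x),
      a != 0, x != 0 & exists u0 u1, lam = qnorm d u0 u1 - x].

(** The matrix k is a similitude of multiplier lam on the span of Q. By Witt's
theorem g can be changed into a similitude h that agrees with k there, so h
preserves the orthogonal complement. Let v be an anisotropic vector of the
complement, of length a, and let h v = u v + w with u in F[sqrt d] and w
orthogonal to the line of v over F[sqrt d]. Comparing lengths, that of w is
a (lam - N u), whence x = N u - lam, which is nonzero as lam is not a norm. *)
Lemma next_block lam (g : 'M[F]_n) r (Q : 'M[F]_(n, r)) (c : 'rV[F]_r) (k : 'M[F]_r) :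
    similitude B g lam -> (forall s t, lam != qnorm d s t) ->
    (r < n)%N -> Q^T *m B *m Q = diag_mx c -> (forall j, c 0 j != 0) -> Jstable Q ->
    similitude (diag_mx c) k lam ->
  exists v w a x, Q^T *m B *m block_frame v w = 0 /\ quaternion_block lam v w a x.
Proof.
move=> sg nl rn QQ c0 stQ sk.
have lam0 : lam != 0.
  by apply: contraNneq (nl 0 0) => ->; rewrite /qnorm expr0n mulr0 subr0.
have lc0 j : (lam *: c) 0 j != 0 by rewrite mxE mulf_neq0.
have uk : k^T \in unitmx.
  have : lam *: diag_mx c \in unitmx by rewrite -linearZ; apply: unitmx_diag.
  by rewrite -sk -mulmxA unitmx_mul => /andP[].
have QgQ : (g *m Q)^T *m B *m (g *m Q) = diag_mx (lam *: c).
  by rewrite congruenceM sg -scalemxAr -scalemxAl QQ linearZ.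
have QkQ : (Q *m k)^T *m B *m (Q *m k) = diag_mx (lam *: c).
  by rewrite congruenceM QQ sk linearZ.
have [b [s [ps sQ]]] := witt_extension two_neq0 symB QgQ QkQ lc0.
have ss := reflection_product_sim symB ps.
have {sg} sh : similitude B (s *m g) lam by rewrite -[lam]mul1r; apply: simM.
have {sQ} hQ : (s *m g) *m Q = Q *m k by rewrite -mulmxA.
move: (s *m g) sh hQ => h sh hQ.
have [v [Qv v0]] := exists_anisotropic_orthogonal two_neq0 symB unitB rn QQ c0.
pose y := h *m v.
have Qy : Q^T *m B *m y = 0.
  have : (Q *m k)^T *m B *m y = 0.
    by rewrite -hQ congruenceM2 sh -scalemxAr -scalemxAl Qv scaler0.
  by rewrite trmx_mul -!mulmxA => /(congr1 (mulmx (invmx k^T))); rewrite mulKmx // mulmx0.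
pose a := bil B v v; pose p := bil B v y; pose q := bil B v (J *m y).
pose u0 := p / a; pose u1 := - q / (- d * a); pose w := y - u0 *: v - u1 *: (J *m v).
have yy : bil B y y = lam * a by rewrite (bil_sim _ _ sh).
have yv : bil B y v = p by rewrite (bilC symB).
have yJv : bil B y (J *m v) = - q by rewrite (bilC symB) bilJ.
have da : a != 0 by [].
have vw : bil B v w = 0.
  rewrite /w !bilBr !bilZr bilJv -/a -/p /u0; by field.
have Jw : J *m w = J *m y - u0 *: (J *m v) - (u1 * d) *: v.
  by rewrite /w !mulmxBr -!scalemxAr (mulmxA J J) sqrJ mul_scalar_mx scalerA.
have vJw : bil B v (J *m w) = 0.
  rewrite Jw !bilBr !bilZr bilJv -/a -/q /u1; by field; rewrite ?oppr_eq0 d_neq0 da.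
have ww : bil B w w = - a * (qnorm d u0 u1 - lam).
  rewrite {1}/w !bilBl !bilZl vw bilJ vJw {1}/w !bilBr !bilZr yy yv yJv.
  by rewrite /qnorm /u0 /u1; field; rewrite ?oppr_eq0 d_neq0 da.
exists v, w, a, (qnorm d u0 u1 - lam); split.
  apply/matrixP => i j; rewrite bil_col col_block_frame mxE.
  have orth (z : 'cV[F]_n) : Q^T *m B *m z = 0 -> bil B (col i Q) z = 0.
    by move=> /matrixP /(_ i 0); rewrite bil_col col_id mxE.
  have Qw : Q^T *m B *m w = 0.
    by rewrite !mulmxBr -!scalemxAr Qv Qy (stQ v) // !scaler0 !subr0.
  by case: j => [[|[|[|[|//]]]] ?] /=; apply: orth => //; apply: stQ.
split=> //; first exact: block_frame_gram.
  by rewrite subr_eq0 eq_sym.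
by exists u0, u1; ring.
Qed.
End Semilinear.

(** * Hermitian discriminants *)

(** The ring R[sqrt d]; the pair (r, s) stands for r + s sqrt d. *)
Definition quad (R : comNzRingType) (d : R) : Type := (R * R)%type.

Section Quad.
Variables (R : comNzRingType) (d : R).
HB.instance Definition _ := GRing.Zmodule.copy (quad d) (R * R)%type.

Definition quad_one : quad d := (1, 0).
Definition quad_mul (x y : quad d) : quad d :=
  (x.1 * y.1 + d * (x.2 * y.2), x.1 * y.2 + x.2 * y.1).

Fact quad_mulA : associative quad_mul.
Proof. by move=> [a b] [e f] [g h]; congr (_, _) => /=; ring. Qed.
Fact quad_mulC : commutative quad_mul.
Proof. by move=> [a b] [e f]; congr (_, _) => /=; ring. Qed.
Fact quad_mul1 : left_id quad_one quad_mul.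
Proof. by move=> [a b]; congr (_, _) => /=; ring. Qed.
Fact quad_mulD : left_distributive quad_mul +%R.
Proof. by move=> [a b] [e f] [g h]; congr (_, _) => /=; ring. Qed.
Fact quad_one_neq0 : quad_one != 0.
Proof. by apply/eqP => -[/eqP]; rewrite oner_eq0. Qed.
HB.instance Definition _ := GRing.Zmodule_isComNzRing.Build (quad d)
  quad_mulA quad_mulC quad_mul1 quad_mulD quad_one_neq0.

Definition quad_conj (x : quad d) : quad d := (x.1, - x.2).
Fact quad_conj_is_additive : zmod_morphism quad_conj.
Proof. by move=> [a b] [e f]; congr (_, _) => /=; ring. Qed.
Fact quad_conj_is_monoid : monoid_morphism quad_conj.
Proof.
by split=> [|[a b] [e f]]; congr (_, _) => /=; ring.
Qed.
HB.instance Definition _ := GRing.isZmodMorphism.Build _ _ quad_conj quad_conj_is_additive.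
HB.instance Definition _ := GRing.isMonoidMorphism.Build _ _ quad_conj quad_conj_is_monoid.

Definition quad_const (a : R) : quad d := (a, 0).
Fact quad_const_is_additive : zmod_morphism quad_const.
Proof. by move=> a b; congr (_, _) => /=; ring. Qed.
Fact quad_const_is_monoid : monoid_morphism quad_const.
Proof. by split=> [|a b]; congr (_, _) => /=; ring. Qed.
HB.instance Definition _ := GRing.isZmodMorphism.Build _ _ quad_const quad_const_is_additive.
HB.instance Definition _ := GRing.isMonoidMorphism.Build _ _ quad_const quad_const_is_monoid.

Lemma quad_conjM x : quad_conj x * x = quad_const (qnorm d x.1 x.2).
Proof. by case: x => a b; congr (_, _) => /=; rewrite /qnorm; ring. Qed.

Lemma quad_sum (I : Type) (r : seq I) (f : I -> quad d) :
  \sum_(i <- r) f i = (\sum_(i <- r) (f i).1, \sum_(i <- r) (f i).2).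
Proof. by elim/big_rec3: _ => // i a b c _ ->. Qed.
End Quad.

(** The Gram matrix of the quadratic form that a diagonal hermitian form over
R[sqrt d] defines over R, in the basis e_1, ..., e_m, sqrt d e_1, ...,
sqrt d e_m. *)
Definition hermitian_gram (R : comNzRingType) (d : R) m (c : 'rV[R]_m) : 'M[R]_(m + m) :=
  block_mx (diag_mx c) 0 0 (- d *: diag_mx c).
(** Multiplication by sqrt d in the same basis. *)
Definition sqrt_action (R : comNzRingType) (d : R) m : 'M[R]_(m + m) :=
  block_mx 0 d%:M 1%:M 0.

(** The columns of X form an orthogonal basis over F[sqrt d]. If T is the matrix
of their coordinates over this ring, with conjugate transpose T', then
T' diag(c0) T = diag(c); take determinants. *)
Lemma hermitian_discriminant (F : fieldType) (d : F) m (c0 c : 'rV[F]_m)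
    (X : 'M[F]_(m + m, m)) : d != 0 ->
    X^T *m hermitian_gram d c0 *m X = diag_mx c ->
    X^T *m hermitian_gram d c0 *m (sqrt_action d m *m X) = 0 ->
  exists s t, \prod_j c 0 j = qnorm d s t * \prod_j c0 0 j.
Proof.
move=> d0; rewrite -[X]vsubmxK; set U := usubmx X; set V := dsubmx X.
rewrite tr_col_mx mul_row_block mul_block_col !(mulmx0, mul0mx, addr0, add0r).
rewrite !mul_row_col mul1mx mul_scalar_mx -!scalemxAr -!scalemxAl => G1 G2.
pose T : 'M[quad d]_m := \matrix_(i, j) (U i j, V i j).
have : (map_mx (@quad_conj _ d) T)^T *m diag_mx (map_mx (quad_const d) c0) *m T =
   diag_mx (map_mx (quad_const d) c).
  apply/matrixP => i j; rewrite mul_mx_diag !mxE quad_sum.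
  have /matrixP /(_ i j) := G1; have /matrixP /(_ i j) := G2.
  rewrite !mul_mx_diag !mxE => e2 e1.
  have -> : (quad_const d (c 0 i)) *+ (i == j) = quad_const d (c 0 i *+ (i == j)).
    by rewrite raddfMn.
  congr (_, _).
    apply: etrans e1; rewrite mulr_sumr -[RHS]big_split /=; apply: eq_bigr => k _; rewrite !mxE /=; ring.
  apply: (mulfI d0); rewrite mulr0; apply: etrans e2; rewrite !mulr_sumr -[RHS]big_split /=.
  by apply: eq_bigr => k _; rewrite !mxE /=; ring.
move=> /(congr1 determinant).
rewrite !det_mulmx det_tr !det_diag det_map_mx mulrAC quad_conjM.
rewrite (eq_bigr (fun i => quad_const d (c0 0 i))) => [|i _]; last by rewrite mxE.
rewrite [RHS](eq_bigr (fun i => quad_const d (c 0 i))) => [|i _]; last by rewrite mxE.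
rewrite -!rmorph_prod -rmorphM => -[e].
by exists (\det T).1, (\det T).2.
Qed.

(** The adjoint of p + r J is its conjugate p - r J. *)
Lemma norm_similitude (R : comNzRingType) n (B J : 'M[R]_n) (d p r : R) :
  J^T *m B = - (B *m J) -> J *m J = d%:M ->
  similitude B (p%:M + r *: J) (qnorm d p r).
Proof.
move=> skewJ sqrJ; rewrite /similitude.
have -> : (p%:M + r *: J)^T *m B = B *m (p%:M - r *: J).
  rewrite [(_ + _)^T]linearD /= tr_scalar_mx [(_ *: _)^T]linearZ /= mulmxDl mulmxBr.
  by rewrite -scalemxAl skewJ scalerN -scalemxAr mul_scalar_mx mul_mx_scalar.
have JJ : (p%:M - r *: J) *m (p%:M + r *: J) = (qnorm d p r)%:M.
  rewrite mulmxBl !mulmxDr -!scalemxAl -!scalemxAr sqrJ !mul_scalar_mx mul_mx_scalar.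
  rewrite opprD addrA addrK.
  by rewrite !scale_scalar_mx -raddfB /=; congr (_%:M); rewrite /qnorm; ring.
by rewrite -mulmxA JJ mul_mx_scalar.
Qed.

(** Multiplication by the elements of the segment from 1 to s + t sqrt d. *)
Lemma multiplier_path_norm (F : fieldType) n (B J : 'M[F]_n) (d s t : F) :
  J^T *m B = - (B *m J) -> J *m J = d%:M ->
  exists2 nu, nu.[1] = qnorm d s t & multiplier_path B nu.
Proof.
move=> skewJ sqrJ.
exists (qnorm d%:P (1 - 'X + 'X * s%:P) ('X * t%:P)).
  by rewrite /qnorm !horner_eval_rules; ring.
exists ((1 - 'X + 'X * s%:P)%:M + ('X * t%:P) *: map_mx polyC J); last first.
  rewrite map_mxD map_scalar_mx map_mxZ /= /horner_eval !horner_eval_rules.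
  by rewrite !mul0r scale0r subr0 !addr0.
apply: norm_similitude.
  by rewrite map_trmx -!map_mxM skewJ map_mxN.
by rewrite -map_mxM sqrJ map_scalar_mx.
Qed.

(** * Paths that reach every multiplier *)

Lemma gram_row_mx (R : comNzRingType) n r s (B : 'M[R]_n) (Q : 'M[R]_(n, r)) (P : 'M[R]_(n, s)) :
  B^T = B -> Q^T *m B *m P = 0 ->
  (row_mx Q P)^T *m B *m row_mx Q P = block_mx (Q^T *m B *m Q) 0 0 (P^T *m B *m P).
Proof.
move=> symB QP; rewrite tr_row_mx mul_col_mx mul_col_row QP.
suff -> : P^T *m B *m Q = 0 by [].
by apply: trmx_inj; rewrite !trmx_mul trmxK symB mulmxA QP trmx0.
Qed.

Lemma diag_block_neq0 (F : fieldType) (d a x : F) : d != 0 -> a != 0 -> x != 0 ->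
  forall j, (a *: block_form d x) 0 j != 0.
Proof.
move=> d0 a0 x0 j; rewrite !mxE mulf_neq0 //.
by case: j => [[|[|[|[|//]]]] ?] /=; rewrite ?oner_neq0 ?oppr_eq0 ?mulf_neq0.
Qed.

Lemma row_mx_neq0 (F : fieldType) r s (c : 'rV[F]_r) (e : 'rV[F]_s) :
  (forall j, c 0 j != 0) -> (forall j, e 0 j != 0) -> forall j, row_mx c e 0 j != 0.
Proof. by move=> c0 e0 j; rewrite mxE; case: splitP => k _; [apply: c0|apply: e0]. Qed.

Lemma unit_of_gram (F : fieldType) n (B Y : 'M[F]_n) (c : 'rV[F]_n) :
  (forall j, c 0 j != 0) -> Y^T *m B *m Y = diag_mx c -> Y \in unitmx.
Proof.
by move=> c0 YY; have := unitmx_diag c0; rewrite -YY unitmx_mul => /andP[].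
Qed.

Lemma block_similitude (R : comNzRingType) (d a x u0 u1 lam : R) :
  lam = qnorm d u0 u1 - x ->
  similitude (a *: diag_mx (block_form d x)) (block_mult d x u0 u1 1 0) lam.
Proof.
move=> ->; apply: similitude_scale.
have := block_mult_sim d x u0 u1 1 0.
by rewrite /qnorm expr1n expr0n mulr0 subr0 mulr1.
Qed.

(** When d is a square, the norm form is hyperbolic and represents every
scalar. *)
Lemma nonsquare_of_nonnorm (F : fieldType) (d lam : F) : 2 != 0 :> F -> d != 0 ->
  (forall s t, lam != qnorm d s t) -> forall r, d != r ^+ 2.
Proof.
move=> two d0 nl r; apply/eqP => dr.
have r0 : r != 0 by apply: contraNneq d0 => r0; rewrite dr r0 expr0n.
have /eqP[] := nl ((lam + 1) / 2) ((lam - 1) / (2 * r)).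
by rewrite /qnorm dr; field; rewrite two r0.
Qed.

Lemma Jstable_row (F : fieldType) n r s (B J : 'M[F]_n) (Q : 'M[F]_(n, r)) (P : 'M[F]_(n, s)) :
  Jstable B J Q -> Jstable B J P -> Jstable B J (row_mx Q P).
Proof.
move=> sQ sP z; rewrite tr_row_mx !mul_col_mx => /eqP.
by rewrite col_mx_eq0 => /andP[/eqP /sQ -> /eqP /sP ->]; rewrite col_mx0.
Qed.

Section Hermitian.
Variables (F : fieldType) (d : F) (m : nat) (c0 : 'rV[F]_m).
Hypothesis d_neq0 : d != 0.
Hypothesis c0_neq0 : forall j, c0 0 j != 0.

Lemma hermitian_gram_diag : hermitian_gram d c0 = diag_mx (row_mx c0 (- d *: c0)).
Proof. by rewrite /hermitian_gram diag_mx_row linearZ. Qed.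

Lemma hermitian_gram_neq0 j : row_mx c0 (- d *: c0) 0 j != 0.
Proof. by apply: row_mx_neq0 => // k; rewrite mxE mulf_neq0 // oppr_eq0. Qed.

Lemma hermitian_gram_unit : hermitian_gram d c0 \in unitmx.
Proof. rewrite hermitian_gram_diag; exact/unitmx_diag/hermitian_gram_neq0. Qed.

Lemma hermitian_gram_sym : (hermitian_gram d c0)^T = hermitian_gram d c0.
Proof. by rewrite hermitian_gram_diag tr_diag_mx. Qed.

Lemma sqrt_action_skew :
  (sqrt_action d m)^T *m hermitian_gram d c0 = - (hermitian_gram d c0 *m sqrt_action d m).
Proof.
rewrite /sqrt_action /hermitian_gram tr_block_mx !trmx0 trmx1 tr_scalar_mx !mulmx_block.
rewrite !(mulmx0, mul0mx, addr0, add0r) mul1mx mulmx1 mul_mx_scalar mul_scalar_mx.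
by rewrite opp_block_mx !oppr0 !scaleNr opprK.
Qed.

Lemma sqrt_action_sqr : sqrt_action d m *m sqrt_action d m = d%:M.
Proof.
rewrite /sqrt_action mulmx_block !(mulmx0, mul0mx, addr0, add0r) mul1mx mulmx1.
by rewrite -scalar_mx_block.
Qed.
End Hermitian.

Section Decomposition.
Variables (F : fieldType) (d : F) (m : nat) (c0 : 'rV[F]_m).
Variables (g : 'M[F]_(m + m)) (lam : F).
Hypothesis two_neq0 : 2 != 0 :> F.
Hypothesis d_neq0 : d != 0.
Hypothesis c0_neq0 : forall j, c0 0 j != 0.
Hypothesis sim_g : similitude (hermitian_gram d c0) g lam.
Hypothesis nonnorm : forall s t, lam != qnorm d s t.

Local Notation B := (hermitian_gram d c0).
Local Notation J := (sqrt_action d m).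
Let symB := hermitian_gram_sym d c0.
Let unitB := hermitian_gram_unit d_neq0 c0_neq0.
Let skewJ := sqrt_action_skew d c0.
Let sqrJ := sqrt_action_sqr d m.
Let next := @next_block _ _ B J d two_neq0 d_neq0 symB unitB skewJ sqrJ lam g.

Lemma two_blocks : (4 < m + m)%N ->
  exists v w a x v' w' a' x', [/\ quaternion_block B J d lam v w a x,
    quaternion_block B J d lam v' w' a' x' &
    (block_frame J v w)^T *m B *m block_frame J v' w' = 0].
Proof.
move=> m4.
have [|||||v [w [a [x [_ qb]]]]] := @next 0 0 0 0 sim_g nonnorm.
- exact: leq_ltn_trans m4.
- by rewrite [LHS]flatmx0 [RHS]flatmx0.
- by case.
- by move=> z _; rewrite [LHS]flatmx0.
- by rewrite /similitude [LHS]flatmx0 [RHS]flatmx0.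
case: (qb) => P1 a0 x0 [u0 [u1 l1]].
have [||||v' [w' [a' [x' [orth qb']]]]] := @next 4 (block_frame J v w)
    (a *: block_form d x) (block_mult d x u0 u1 1 0) sim_g nonnorm m4.
- by rewrite P1 linearZ.
- exact: diag_block_neq0.
- exact: block_frame_stable skewJ sqrJ _ _.
- by rewrite linearZ; apply: block_similitude.
by exists v, w, a, x, v', w', a', x'.
Qed.

Lemma gram_two_blocks v w a x v' w' a' x' :
    quaternion_block B J d lam v w a x -> quaternion_block B J d lam v' w' a' x' ->
    (block_frame J v w)^T *m B *m block_frame J v' w' = 0 ->
  (row_mx (block_frame J v w) (block_frame J v' w'))^T *m B *m
    row_mx (block_frame J v w) (block_frame J v' w') =
  block_mx (a *: diag_mx (block_form d x)) 0 0 (a' *: diag_mx (block_form d x')).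
Proof. by move=> [P _ _ _] [P' _ _ _] orth; rewrite gram_row_mx // P P'. Qed.

Lemma third_block v w a x v' w' a' x' : (8 < m + m)%N ->
    quaternion_block B J d lam v w a x -> quaternion_block B J d lam v' w' a' x' ->
    (block_frame J v w)^T *m B *m block_frame J v' w' = 0 ->
  exists v'' w'' a'' x'', quaternion_block B J d lam v'' w'' a'' x'' /\
    (row_mx (block_frame J v w) (block_frame J v' w'))^T *m B *m
      block_frame J v'' w'' = 0.
Proof.
move=> m8 qb qb' orth; have PP := gram_two_blocks qb qb' orth.
case: qb => _ a0 x0 [u0 [u1 l1]]; case: qb' => _ a'0 x'0 [u0' [u1' l2]].
have [||||v'' [w'' [a'' [x'' [orth' qb'']]]]] := @next (4 + 4)
    (row_mx (block_frame J v w) (block_frame J v' w'))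
    (row_mx (a *: block_form d x) (a' *: block_form d x'))
    (block_mx (block_mult d x u0 u1 1 0) 0 0 (block_mult d x' u0' u1' 1 0)) sim_g nonnorm m8.
- by rewrite PP diag_mx_row !linearZ.
- by apply: row_mx_neq0; apply: diag_block_neq0.
- by apply: Jstable_row; apply: block_frame_stable skewJ sqrJ _ _.
- rewrite diag_mx_row !linearZ.
  by apply: similitude_block; apply: block_similitude.
by exists v'', w'', a'', x''.
Qed.
End Decomposition.

Lemma qnormM (R : comNzRingType) (d s t s' t' : R) :
  qnorm d s t * qnorm d s' t' = qnorm d (s * s' + d * t * t') (s * t' + t * s').
Proof. by rewrite /qnorm; ring. Qed.

Lemma col_row_mxl (R : Type) n r s (A : 'M[R]_(n, r)) (C : 'M[R]_(n, s)) k :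
  col (lshift s k) (row_mx A C) = col k A.
Proof. by apply/matrixP => i j; rewrite !mxE (unsplitK (inl k)). Qed.

Lemma col_row_mxr (R : Type) n r s (A : 'M[R]_(n, r)) (C : 'M[R]_(n, s)) k :
  col (rshift r k) (row_mx A C) = col k C.
Proof. by apply/matrixP => i j; rewrite !mxE (unsplitK (inr k)). Qed.

(** The vectors v_i and w_i form an orthogonal basis over F[sqrt d], of hermitian
lengths a_i and - a_i x_i. Modulo norms, the product of these lengths is
- x1 x2 x3, and it is also the product of the c0_j. *)
Lemma three_blocks_discriminant (F : fieldType) (d : F) (c0 : 'rV[F]_6)
    (v1 w1 v2 w2 v3 w3 : 'cV[F]_(6 + 6)) (a1 x1 a2 x2 a3 x3 s t : F) :
    let J := sqrt_action d 6 in
    let Y := row_mx (row_mx (block_frame J v1 w1) (block_frame J v2 w2))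
      (block_frame J v3 w3) in
    d != 0 -> a1 != 0 -> a2 != 0 -> a3 != 0 ->
    Y^T *m hermitian_gram d c0 *m Y =
      diag_mx (row_mx (row_mx (a1 *: block_form d x1) (a2 *: block_form d x2))
        (a3 *: block_form d x3)) ->
    - \prod_j c0 0 j = qnorm d s t ->
  exists f0 f1, x1 * x2 * x3 = qnorm d f0 f1.
Proof.
move=> J Y d0 a10 a20 a30 YY cst.
pose i0 : 'I_4 := @Ordinal 4 0 isT; pose i1 : 'I_4 := @Ordinal 4 1 isT.
pose i2 : 'I_4 := @Ordinal 4 2 isT; pose i3 : 'I_4 := @Ordinal 4 3 isT.
(* For p = 0 and q = 2, the positions of v_1, w_1, v_2, w_2, v_3, w_3 among the
   twelve columns of Y; for p = 1 and q = 3, those of their images under J. *)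
pose idx (p q : 'I_4) (j : 'I_6) : 'I_(4 + 4 + 4) := nth (rshift (4 + 4) i0)
  [:: lshift 4 (lshift 4 p); lshift 4 (lshift 4 q); lshift 4 (rshift 4 p);
      lshift 4 (rshift 4 q); rshift (4 + 4) p; rshift (4 + 4) q] j.
pose X : 'M[F]_(6 + 6, 6) := colsub (idx i0 i2) Y.
have JX : J *m X = colsub (idx i1 i3) Y.
  apply/matrixP => i j.
  have : J *m col (idx i0 i2 j) Y = col (idx i1 i3 j) Y.
    by case: j => [[|[|[|[|[|[|//]]]]]] ?];
      rewrite /idx /= !(col_row_mxl, col_row_mxr) !col_block_frame.
  move=> /matrixP /(_ i 0); rewrite !mxE => <-.
  by apply: eq_bigr => k _; rewrite !mxE.
have colX f j : col j (colsub f Y) = col (f j) Y by apply/matrixP => i k; rewrite !mxE.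
pose cc := row_mx (row_mx (a1 *: block_form d x1) (a2 *: block_form d x2))
  (a3 *: block_form d x3).
have G1 : X^T *m hermitian_gram d c0 *m X = diag_mx (\row_j cc 0 (idx i0 i2 j)).
  apply/matrixP => i j; rewrite bil_col !colX -bil_col YY -/cc !mxE.
  congr (_ *+ _).
  by case: i => [[|[|[|[|[|[|//]]]]]] ?]; case: j => [[|[|[|[|[|[|//]]]]]] ?].
have G2 : X^T *m hermitian_gram d c0 *m (J *m X) = 0.
  rewrite JX; apply/matrixP => i j; rewrite bil_col !colX -bil_col YY -/cc !mxE.
  by case: i => [[|[|[|[|[|[|//]]]]]] ?]; case: j => [[|[|[|[|[|[|//]]]]]] ?].
have splitl r q (k : 'I_r) : split (lshift q k) = inl k := unsplitK (inl k).
have splitr r q (k : 'I_q) : split (rshift r k) = inr k := unsplitK (inr k).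
have [s' [t']] := hermitian_discriminant d0 G1 G2.
move: cst; move: (\prod_j c0 0 j) => C0 cst.
rewrite !big_ord_recl big_ord0 !mxE /idx /= /cc !(splitl, splitr).
rewrite !mxE !(splitl, splitr) !mxE /= => e.
have nz : a1 * a2 * a3 != 0 by rewrite !mulf_neq0.
have : qnorm d s t * qnorm d s' t' = (a1 * a2 * a3) ^+ 2 * (x1 * x2 * x3).
  by rewrite -cst mulrC mulrN -e; ring.
rewrite qnormM; set f0 := _ + _; set f1 := _ + _ => ef.
exists (f0 / (a1 * a2 * a3)), (f1 / (a1 * a2 * a3)).
have -> : qnorm d (f0 / (a1 * a2 * a3)) (f1 / (a1 * a2 * a3)) =
    qnorm d f0 f1 / (a1 * a2 * a3) ^+ 2.
  by rewrite /qnorm; move: nz; set a := a1 * _ * _ => nz; field.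
by rewrite ef [RHS]mulrAC mulfV ?mul1r // expf_neq0.
Qed.

(** A norm lam is reached by a segment in F[sqrt d]; for any other lam the form is
a sum of two quaternion blocks. *)
Lemma multiplier_path_rank4 (F : fieldType) (d : F) (c0 : 'rV[F]_4) g lam :
    2 != 0 :> F -> d != 0 -> (forall j, c0 0 j != 0) ->
    similitude (hermitian_gram d c0) g lam ->
  exists nu c, [/\ c != 0, nu.[1] = lam * c ^+ 2 &
    multiplier_path (hermitian_gram d c0) nu].
Proof.
move=> two d0 c00 sg.
have [[s [t lst]]|nl] := pselect (exists s t, lam = qnorm d s t).
  have [nu nu1 pnu] := @multiplier_path_norm _ _ (hermitian_gram d c0)
    (sqrt_action d 4) d s t (sqrt_action_skew d c0) (sqrt_action_sqr d 4).
  by exists nu, 1; rewrite oner_neq0 expr1n mulr1 lst.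
have {}nl s t : lam != qnorm d s t by apply/eqP => e; apply: nl; exists s, t.
have [//|v1 [w1 [a1 [x1 [v2 [w2 [a2 [x2 [b1 b2 orth]]]]]]]]] :=
  two_blocks two d0 c00 sg nl.
have YY := gram_two_blocks b1 b2 orth.
case: b1 b2 => [_ a10 x10 [u0 [u1 l1]]] [_ a20 x20 [u0' [u1' l2]]].
have [nu [c [c0' nu1 p1 p2]]] := norm_paths2 two l1 l2.
exists nu, c; split=> //.
apply: (@multiplier_path_congr _ (4 + 4) _ (row_mx (block_frame (sqrt_action d 4) v1 w1)
   (block_frame (sqrt_action d 4) v2 w2))).
  apply: (@unit_of_gram _ _ (hermitian_gram d c0) _
    (row_mx (a1 *: block_form d x1) (a2 *: block_form d x2))).
    by apply: row_mx_neq0; apply: diag_block_neq0.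
  by rewrite YY diag_mx_row !linearZ.
by rewrite YY; apply: multiplier_path_sum; apply: multiplier_path_block.
Qed.

(** In rank 6 there are three blocks, and the condition on the c0_j makes
x1 x2 x3 a norm. *)
Lemma multiplier_path_rank6 (F : fieldType) (d : F) (c0 : 'rV[F]_6) g lam s t :
    2 != 0 :> F -> d != 0 -> (forall j, c0 0 j != 0) ->
    - \prod_j c0 0 j = qnorm d s t ->
    similitude (hermitian_gram d c0) g lam ->
  exists nu c, [/\ c != 0, nu.[1] = lam * c ^+ 2 &
    multiplier_path (hermitian_gram d c0) nu].
Proof.
move=> two d0 c00 cst sg.
have [[p [q lpq]]|nl] := pselect (exists s t, lam = qnorm d s t).
  have [nu nu1 pnu] := @multiplier_path_norm _ _ (hermitian_gram d c0)
    (sqrt_action d 6) d p q (sqrt_action_skew d c0) (sqrt_action_sqr d 6).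
  by exists nu, 1; rewrite oner_neq0 expr1n mulr1 lpq.
have {}nl p q : lam != qnorm d p q by apply/eqP => e; apply: nl; exists p, q.
have [//|v1 [w1 [a1 [x1 [v2 [w2 [a2 [x2 [b1 b2 orth]]]]]]]]] :=
  two_blocks two d0 c00 sg nl.
have [//|v3 [w3 [a3 [x3 [b3 orth']]]]] := third_block two d0 c00 sg nl _ b1 b2 orth.
have YY := gram_two_blocks b1 b2 orth.
have YYY := gram_row_mx (hermitian_gram_sym d c0) orth'; rewrite YY in YYY.
case: b1 b2 b3 YYY => [_ a10 x10 [u0 [u1 l1]]] [_ a20 x20 [u0' [u1' l2]]].
move=> [-> a30 x30 [u0'' [u1'' l3]]] YYY.
pose cc := row_mx (row_mx (a1 *: block_form d x1) (a2 *: block_form d x2))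
  (a3 *: block_form d x3).
have cc0 j : cc 0 j != 0.
  by apply: row_mx_neq0 => [|k]; [apply: row_mx_neq0|]; apply: diag_block_neq0.
have D := YYY; rewrite (_ : block_mx _ _ _ _ = diag_mx cc) in D; last first.
  by rewrite !diag_mx_row !linearZ.
have [f0 [f1 xxx]] := three_blocks_discriminant d0 a10 a20 a30 D cst.
have dns := nonsquare_of_nonnorm two d0 nl.
have [nu [c [c0' nu1 p1 p2 p3]]] := norm_paths3 two dns x10 x20 x30 l1 l2 l3 xxx.
exists nu, c; split=> //.
apply: (@multiplier_path_congr _ (4 + 4 + 4) _ (row_mx (row_mx
   (block_frame (sqrt_action d 6) v1 w1) (block_frame (sqrt_action d 6) v2 w2))
   (block_frame (sqrt_action d 6) v3 w3))).
  apply: (@unit_of_gram _ _ (hermitian_gram d c0) _ cc _ D).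
  exact: cc0.
rewrite YYY; apply: multiplier_path_sum; last exact: multiplier_path_block.
by apply: multiplier_path_sum; apply: multiplier_path_block.
Qed.

(** * Automorphisms with involution are conjugations by similitudes *)

Section Endo.
Variables (F : fieldType) (n : nat).
Implicit Types (G : 'M[F]_(n * n)) (A : 'M[F]_n).

Fact endo_is_linear G : linear (endo G).
Proof. by move=> a A C; rewrite /endo !linearP /= mulmxDl -scalemxAl linearP. Qed.
HB.instance Definition _ G :=
  GRing.isLinear.Build F 'M[F]_n 'M[F]_n _ (endo G) (endo_is_linear G).

Lemma endo_inj G G' : (forall A, endo G A = endo G' A) -> G = G'.
Proof.
move=> e; apply/row_matrixP => i; rewrite !rowE.
have := e (vec_mx (delta_mx 0 i)); rewrite /endo vec_mxK.
exact: can_inj vec_mxK _ _.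
Qed.

Lemma mulmx_delta A (k i0 : 'I_n) : A *m delta_mx k i0 = \sum_l A l k *: delta_mx l i0.
Proof.
apply/matrixP => i j; rewrite summxE !mxE (bigD1 k) //= !mxE eqxx.
rewrite big1 ?addr0 => [|l lk]; last by rewrite !mxE (negPf lk) mulr0.
rewrite (bigD1 i) //= !mxE eqxx big1 ?addr0 // => l li.
by rewrite !mxE eq_sym (negPf li) mulr0.
Qed.

Lemma scalar_of_central (n_gt0 : (0 < n)%N) S :
  (forall A, S *m A = A *m S) -> exists mu, S = mu%:M.
Proof.
move=> cS; pose i0 := Ordinal n_gt0; exists (S i0 i0).
apply/matrixP => i j; have /matrixP /(_ i i0) := cS (delta_mx j i0).
rewrite !mxE (bigD1 j) //= !mxE !eqxx mulr1 big1 ?addr0 => [->|l lj]; last first.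
  by rewrite !mxE (negPf lj) mulr0.
rewrite (bigD1 i0) //= !mxE eqxx andbT big1 ?addr0 => [|l li]; last first.
  by rewrite !mxE (negPf li) andbF mul0r.
by rewrite mulr_natl.
Qed.

(** Write e_kl for the matrix units. The image of e_00 is nonzero, so some vector
j0 of the standard basis is not killed by it; g takes the k-th vector of the
standard basis to the image of e_k0 applied to j0. The kernel of g is stable
under all matrices, hence zero. *)
Lemma skolem_noether (n_gt0 : (0 < n)%N) G : G \in unitmx ->
    (forall A C, endo G (A *m C) = endo G A *m endo G C) ->
  exists2 g, g \in unitmx & forall A, endo G A *m g = g *m A.
Proof.
move=> uG mG; pose i0 := Ordinal n_gt0.
have : endo G (delta_mx i0 i0) != 0.
  rewrite /endo (can2_eq vec_mxK mxvecK) linear0.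
  apply/eqP => /(congr1 (mulmxr (invmx G))) /=; rewrite mulmxK // mul0mx => /eqP.
  rewrite mxvec_eq0 => /eqP /matrixP /(_ i0 i0) /eqP.
  by rewrite !mxE !eqxx oner_eq0.
case/matrix0Pn => k0 [j0 nz].
pose g := \matrix_(i, k) endo G (delta_mx k i0) i j0.
have colg k : col k g = col j0 (endo G (delta_mx k i0)).
  by apply/matrixP => i l; rewrite !mxE.
have gA A : endo G A *m g = g *m A.
  apply/matrixP => i k; rewrite !mxE.
  transitivity (endo G (A *m delta_mx k i0) i j0).
    by rewrite mG !mxE; apply: eq_bigr => l _; rewrite !mxE.
  rewrite mulmx_delta linear_sum summxE; apply: eq_bigr => l _.
  by rewrite linearZ !mxE mulrC.
exists g => //; rewrite unitmxE unitfE -det_tr; apply/negP => /det0P[w w0 wg].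
have gw : g *m w^T = 0 by apply: trmx_inj; rewrite trmx_mul trmxK wg trmx0.
case/rV0Pn: w0 => l wl.
have g0 : g *m delta_mx i0 (0 : 'I_1) = 0.
  have : g *m (delta_mx i0 l *m w^T) = 0 by rewrite mulmxA -gA -mulmxA gw mulmx0.
  have -> : delta_mx i0 l *m w^T = w 0 l *: delta_mx i0 0.
    apply/matrixP => i j; rewrite !mxE ord1 eqxx andbT (bigD1 l) //= big1 ?addr0.
      by rewrite !mxE eqxx andbT mulrC.
    by move=> k kl; rewrite !mxE (negPf kl) andbF mul0r.
  by rewrite -scalemxAr => /eqP; rewrite scaler_eq0 (negPf wl) => /eqP.
case/eqP: nz; have <- : col j0 (endo G (delta_mx i0 i0)) k0 0 = endo G (delta_mx i0 i0) k0 j0.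
  by rewrite [LHS]mxE.
by rewrite -colg colE g0 [LHS]mxE.
Qed.

(** That conjugation by g commutes with the adjoint involution means that the
product of the adjoint of g and g is central. *)
Lemma similitude_of_automorphism (n_gt0 : (0 < n)%N) (B : 'M[F]_n) G :
    B^T = B -> B \in unitmx -> involution_automorphism B G ->
  exists g mu, [/\ similitude B g mu, mu != 0, g \in unitmx &
    forall A, endo G A *m g = g *m A].
Proof.
move=> symB uB [uG _ mG iG].
have [g ug gA] := skolem_noether n_gt0 uG mG.
have GA A : endo G A = g *m A *m invmx g by rewrite -gA mulmxK.
have [mu Smu] : exists mu, invmx B *m g^T *m B *m g = mu%:M.
  apply: scalar_of_central => // C.
  pose A := (B *m C *m invmx B)^T.
  have CA : adjoint_involution B A = C.
    by rewrite /adjoint_involution trmxK !mulmxA mulVmx // mul1mx mulmxKV.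
  have := iG A; rewrite CA !GA /adjoint_involution !trmx_mul => e.
  have {}e : g *m C = invmx B *m ((invmx g)^T *m (A^T *m g^T)) *m B *m g.
    by rewrite -e mulmxKV.
  transitivity (invmx B *m A^T *m g^T *m B *m g).
    rewrite -[LHS]mulmxA e !mulmxA mulmxK // -[_ *m g^T *m (invmx g)^T]mulmxA.
    by rewrite -trmx_mul mulVmx // trmx1 mulmx1.
  by rewrite -[in RHS]CA /adjoint_involution !mulmxA mulmxK.
have sg : similitude B g mu.
  by rewrite /similitude -[RHS]mul_mx_scalar -Smu !mulmxA mulmxV // mul1mx.
exists g, mu; split=> //; apply/eqP => mu0.
have : g^T *m B *m g \in unitmx by rewrite !unitmx_mul unitmx_tr ug uB.
by move/(unitmx_neq0 n_gt0); rewrite sg mu0 scale0r eqxx.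
Qed.
End Endo.

(** With B' the inverse of B, this is the multiplier times conjugation by a
similitude g; it is polynomial in g, because the inverse of g is, up to the
multiplier, its adjoint. *)
Definition conj_numerator (R : comNzRingType) n (B' B g : 'M[R]_n) : 'M[R]_(n * n) :=
  lin_mulmx g *m lin_mulmxr (B' *m g^T *m B).

Lemma map_conj_numerator (R S : comNzRingType) (f : {rmorphism R -> S}) n (B' B g : 'M[R]_n) :
  map_mx f (conj_numerator B' B g) =
  conj_numerator (map_mx f B') (map_mx f B) (map_mx f g).
Proof.
rewrite /conj_numerator map_mxM; congr (_ *m _); apply: map_lin_mx => A.
  by rewrite map_mxM.
by rewrite /= !map_mxM map_trmx.
Qed.

Lemma mul_conj_numerator (R : comNzRingType) n (B' B g A : 'M[R]_n) :
  vec_mx (mxvec A *m conj_numerator B' B g) = g *m A *m (B' *m g^T *m B).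
Proof. by rewrite /conj_numerator [X in vec_mx X]mulmxA !mul_vec_lin mxvecK. Qed.

Section Conj.
Variables (F : fieldType) (n : nat) (B g : 'M[F]_n) (mu : F).
Hypothesis symB : B^T = B.
Hypothesis unitB : B \in unitmx.
Hypothesis sim_g : similitude B g mu.
Hypothesis mu_neq0 : mu != 0.

Definition conj_mx := mu^-1 *: conj_numerator (invmx B) B g.
Let gi := mu^-1 *: (invmx B *m g^T *m B).

Lemma sim_inverse : gi *m g = 1%:M.
Proof.
rewrite /gi -scalemxAl -!mulmxA [g^T *m _]mulmxA sim_g -scalemxAr mulVmx //.
by rewrite scalerA mulVf // scale1r.
Qed.

Lemma endo_conj_mx A : endo conj_mx A = g *m A *m gi.
Proof.
by rewrite /endo -scalemxAr linearZ /= mul_conj_numerator scalemxAr.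
Qed.

Lemma conj_mx_unique G : (forall A, endo G A *m g = g *m A) -> G = conj_mx.
Proof.
move=> gA; apply: endo_inj => A; rewrite endo_conj_mx -gA -mulmxA.
by rewrite (mulmx1C sim_inverse) mulmx1.
Qed.

Lemma conj_mx_automorphism : involution_automorphism B conj_mx.
Proof.
have ggi := mulmx1C sim_inverse.
split.
- rewrite -row_free_unit; apply: inj_row_free => v v0.
  have : endo conj_mx (vec_mx v) = 0 by rewrite /endo vec_mxK v0 linear0.
  rewrite endo_conj_mx => /(congr1 (fun M => gi *m M *m g)).
  rewrite !mulmxA sim_inverse mul1mx -mulmxA sim_inverse mulmx1 mulmx0 mul0mx.
  by move=> /(congr1 mxvec); rewrite vec_mxK linear0.
- by rewrite endo_conj_mx mulmx1.
- move=> A C; rewrite !endo_conj_mx !mulmxA; congr (_ *m _ *m _).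
  by rewrite -[RHS]mulmxA sim_inverse mulmx1.
- move=> A; rewrite !endo_conj_mx /adjoint_involution !trmx_mul /gi.
  rewrite [X in _ = _ *m (X *m _) *m _]linearZ /= !trmx_mul trmxK trmx_inv symB.
  rewrite -!scalemxAl -!scalemxAr -!scalemxAl !mulmxA mulVmx // mul1mx.
  by rewrite mulmxK.
Qed.

End Conj.

(** * Connected components in the Zariski topology and specialization *)

Section Zariski.
Variables (K : fieldType) (N : nat).
Implicit Types (P Q : affine_point K N).
Local Open Scope classical_set_scope.

Lemma open_specialization P Q (U : set (affine_point K N)) :
  point_ideal Q `<=` point_ideal P -> open U -> U P -> U Q.
Proof.
move=> QP [D sD <-] [V DV VP]; exists V => //.
have [/= s ss VE] := sD _ DV; rewrite /= -VE => W sW.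
have [p _ WE] := set_mem (ss _ sW).
have : W P by rewrite /= -VE in VP; apply: VP.
rewrite -WE => nP /QP; exact: nP.
Qed.

Lemma open_principal (p : mpoly N K) : open (@principal_open K N p).
Proof.
exists [set @principal_open K N p]; last by rewrite bigcup_set1.
move=> _ ->; apply: finI_from1; by exists p.
Qed.
End Zariski.

Section Components.
Variables (K : fieldType) (N : nat) (X : set (affine_point K N)).
Implicit Types (P Q : affine_point K N).
Local Open Scope classical_set_scope.

(** A set that consists of a point and a specialization of it is connected. *)
Lemma component_specialization P Q :
  X P -> X Q -> point_ideal Q `<=` point_ideal P -> connected_component X Q P.
Proof.
move=> XP XQ QP; pose A := [set Q; P].
apply: (@connected_component_max _ _ A) => //; [by left | by move=> R [->|->] | | by right].
move=> C [R CR] [U oU CU] [V cV CV].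
suff [CP CQ] : C P /\ C Q.
  by apply/seteqP; split=> [S|S [->|->]] //; rewrite CU => -[].
have AQ : A Q by left.
have AP : A P by right.
have CQ : C Q.
  have AR : A R by rewrite CU in CR; case: CR.
  case: AR => /= RE; rewrite RE // in CR; rewrite CU in CR *; case: CR => _ UP.
  split=> //; exact: open_specialization QP oU UP.
split=> //; rewrite CV; split=> //; apply: contrapT => nVP.
have oV : open (~` V) by rewrite openC.
have := open_specialization QP oV nVP; apply.
by rewrite CV in CQ; case: CQ.
Qed.

(** The zero loci of p and r on X are closed, disjoint and cover X, so the first
one is also open in X. *)
Lemma component_zero_locus (p r : mpoly N K) P Q :
    (forall R, X R -> point_ideal R p \/ point_ideal R r) ->
    (forall R, X R -> point_ideal R p -> ~ point_ideal R r) ->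
  connected_component X P Q -> point_ideal P p -> point_ideal Q p.
Proof.
move=> cover disj [C [CP CX cC] CQ] Pp.
pose D := C `&` [set R | point_ideal R p].
suff DC : D = C by rewrite -DC in CQ; case: CQ.
apply: cC; first by exists P.
- exists (@principal_open K N r); first exact: open_principal.
  apply/seteqP; split=> R [CR] /= pR; split=> //.
    exact: disj (CX _ CR) pR.
  by case: (cover R (CX _ CR)).
- exists (~` @principal_open K N p).
    by rewrite closedC; apply: open_principal.
  apply/seteqP; split=> R [CR] pR; split=> //.
  exact: contrapT.
Qed.
End Components.

Section TakesValue.
Variables (F : fieldType) (a : F).

Lemma takes_valueC c : takes_value (FracField.tofrac c%:P) a c.
Proof.
exists c%:P, 1; rewrite !hornerC oner_neq0; split=> //.
  by rewrite tofrac1 divr1.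
by rewrite divr1.
Qed.

Lemma takes_valueD f g v w :
  takes_value f a v -> takes_value g a w -> takes_value (f + g) a (v + w).
Proof.
move=> [p [d [d0 -> ->]]] [r [e [e0 -> ->]]].
have nz (s : {poly F}) : s.[a] != 0 -> FracField.tofrac s != 0.
  by move=> sa; rewrite tofrac_eq0; apply: contraNneq sa => ->; rewrite horner0.
exists (p * e + r * d), (d * e); split; rewrite ?hornerM ?mulf_neq0 //.
  by rewrite addf_div ?nz // tofracD !tofracM.
by rewrite addf_div // hornerD !hornerM.
Qed.

Lemma takes_valueM f g v w :
  takes_value f a v -> takes_value g a w -> takes_value (f * g) a (v * w).
Proof.
move=> [p [d [d0 -> ->]]] [r [e [e0 -> ->]]].
have nz (s : {poly F}) : s.[a] != 0 -> FracField.tofrac s != 0.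
  by move=> sa; rewrite tofrac_eq0; apply: contraNneq sa => ->; rewrite horner0.
exists (p * r), (d * e); split; rewrite ?hornerM ?mulf_neq0 //.
  by rewrite mulf_div !tofracM.
by rewrite mulf_div.
Qed.

Lemma takes_value_zero v : takes_value 0 a v -> v = 0.
Proof.
move=> [p [d [d0 e ->]]].
have nz : FracField.tofrac d != 0.
  by rewrite tofrac_eq0; apply: contraNneq d0 => ->; rewrite horner0.
move/eqP: e; rewrite eq_sym mulf_eq0 invr_eq0 (negPf nz) orbF tofrac_eq0.
by move=> /eqP ->; rewrite horner0 mul0r.
Qed.

Lemma takes_value_mmap (K : fieldType) (i : {rmorphism K -> F}) N
    (f : 'rV[{fraction {poly F}}]_N) (x : 'rV[F]_N) (p : mpoly N K) :
  (forall k, takes_value (f 0 k) a (x 0 k)) ->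
  takes_value (mmap (to_ratfun i) (f 0) p) a (mmap i (x 0) p).
Proof.
move=> fx; rewrite /mmap /mmap1.
apply: (big_ind2 (fun f v => takes_value f a v)).
- by rewrite -tofrac0 -polyC0; apply: takes_valueC.
- by move=> *; apply: takes_valueD.
move=> m _; apply: takes_valueM; first exact: takes_valueC.
apply: (big_ind2 (fun f v => takes_value f a v)).
- by rewrite -tofrac1 -polyC1; apply: takes_valueC.
- by move=> *; apply: takes_valueM.
move=> k _; elim: (m k) => [|e IH].
  by rewrite !expr0 -tofrac1 -polyC1; apply: takes_valueC.
by rewrite !exprS; apply: takes_valueM.
Qed.
End TakesValue.

Lemma point_of_map (K : fieldType) N (F L : fieldType) (i : {rmorphism K -> F})
    (j : {rmorphism F -> L}) (x : 'rV[F]_N) (h : {rmorphism K -> L}) :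
  h =1 j \o i -> point_of h (map_mx j x) = point_of i x.
Proof.
move=> hji.
have e p : mmap h (map_mx j x 0) p = j (mmap i (x 0) p).
  rewrite /mmap rmorph_sum; apply: eq_bigr => m _; rewrite rmorphM hji; congr (_ * _).
  rewrite /mmap1 rmorph_prod; apply: eq_bigr => k _.
  by rewrite rmorphXn mxE.
rewrite /point_of; set A := ex_intro _ _ _; set C := ex_intro _ _ _.
have E : [set p | mmap h (map_mx j x 0) p = 0]%classic = [set p | mmap i (x 0) p = 0]%classic.
  apply/seteqP; split=> p /=; rewrite e; last by move=> ->; rewrite rmorph0.
  by move/eqP; rewrite fmorph_eq0 => /eqP.
move: A C; rewrite E => A C; congr AffinePoint; exact: Prop_irrelevance.
Qed.

(** * Proper similitudes and the identity component *)

(** If G is conjugation by a similitude g of multiplier mu, this is det g / mu^m.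
In each term of the Leibniz formula for det g the factors from rows k and m + k
are paired, and a product of two entries of g divided by mu is linear in G: it is
an entry of g E g^T / mu = G(E B) B^-1, with E a matrix unit. *)
Definition proper_sign (R : comNzRingType) m (B' B : 'M[R]_(m + m))
    (G : 'M[R]_((m + m) * (m + m))) : R :=
  \sum_(s : 'S_(m + m)) (-1) ^+ s * \prod_(k < m)
    (vec_mx (mxvec (delta_mx (s (lshift m k)) (s (rshift m k)) *m B) *m G) *m B')
      (lshift m k) (rshift m k).

Lemma map_proper_sign (R S : comNzRingType) (f : {rmorphism R -> S}) m
    (B' B : 'M[R]_(m + m)) G :
  f (proper_sign B' B G) =
  proper_sign (map_mx f B') (map_mx f B) (map_mx f G).
Proof.
rewrite /proper_sign rmorph_sum; apply: eq_bigr => s _.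
rewrite rmorphM rmorph_sign rmorph_prod; congr (_ * _); apply: eq_bigr => k _.
by rewrite -(map_delta_mx f) -map_mxM -map_mxvec -map_mxM -map_vec_mx -map_mxM [RHS]mxE.
Qed.

Lemma proper_sign_conj (F : fieldType) m (B g : 'M[F]_(m + m)) mu :
  B \in unitmx -> 
  proper_sign (invmx B) B (conj_mx B g mu) = \det g / mu ^+ m.
Proof.
move=> uB; rewrite /proper_sign /determinant mulr_suml; apply: eq_bigr => s _.
rewrite -mulrA; congr (_ * _); rewrite big_split_ord /= -big_split /=.
have -> : (mu ^+ m)^-1 = \prod_(k < m) mu^-1 by rewrite prodr_const card_ord exprVn.
rewrite -big_split /=.
apply: eq_bigr => k _.
rewrite /conj_mx -scalemxAr linearZ /= mul_conj_numerator.
set E := delta_mx _ _.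
have -> : g *m (E *m B) *m (invmx B *m g^T *m B) = g *m E *m g^T *m B.
  by rewrite !mulmxA -[_ *m B *m invmx B]mulmxA mulmxV // mulmx1.
rewrite -scalemxAl mulmxK // mxE mulrC; congr (_ * _).
rewrite !mxE (bigD1 (s (rshift m k))) //= !mxE (bigD1 (s (lshift m k))) //= !mxE !eqxx mulr1.
rewrite [X in (_ + X) * _]big1 ?addr0 => [|l ls]; last by rewrite !mxE (negPf ls) mulr0.
rewrite [X in _ + X]big1 ?addr0 // => l ls.
rewrite !mxE big1 ?mul0r // => r _.
by rewrite !mxE (negPf ls) andbF mulr0.
Qed.

Lemma det_similitude (F : fieldType) m (B g : 'M[F]_(m + m)) mu :
  B \in unitmx -> similitude B g mu -> (\det g) ^+ 2 = (mu ^+ m) ^+ 2.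
Proof.
move=> uB /(congr1 determinant); rewrite !det_mulmx det_tr detZ => e.
have B0 : \det B != 0 by rewrite -unitfE -unitmxE.
apply: (mulIf B0); rewrite -exprM -[(m * 2)%N]/(muln m 2) mulnC mul2n -addnn -e.
by rewrite expr2 mulrAC.
Qed.

Section Points.
Variables (K : fieldType) (m : nat) (q : 'cV[K]_(m + m) -> K).
Hypothesis two_neq0 : 2 != 0 :> K.
Hypothesis m_gt0 : (0 < m + m)%N.
Let n := (m + m)%N.
Hypothesis symB : (gram q)^T = gram q.
Hypothesis unitB : gram q \in unitmx.

Lemma PGO_one (F : fieldType) (i : {rmorphism K -> F}) : PGO q i (mxvec 1%:M).
Proof.
rewrite /PGO /= mxvecK.
have e A : endo (1%:M : 'M[F]_(n * n)) A = A by rewrite /endo mulmx1 mxvecK.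
by split; rewrite ?unitmx1 // => *; rewrite !e.
Qed.

Lemma PGO_plus_one (F : fieldType) (i : {rmorphism K -> F}) :
  PGO_plus q i (mxvec 1%:M).
Proof.
split; first exact: PGO_one.
have -> : mxvec (1%:M : 'M[F]_(n * n)) = map_mx i (mxvec 1%:M).
  by rewrite map_mxvec map_mx1.
rewrite (@point_of_map _ _ _ _ idfun i _ i) //.
apply: connected_component_refl; exists K, idfun, (mxvec 1%:M); split=> //.
exact: PGO_one.
Qed.

Definition sign_polynomial : mpoly ((n * n) * (n * n)) K :=
  proper_sign (map_mx (@mpolyC _ K) (invmx (gram q))) (map_mx (@mpolyC _ K) (gram q))
    (vec_mx (\row_k mpolyX K (mnm1 k))).

Lemma mmap_sign_polynomial (F : fieldType) (i : {rmorphism K -> F})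
    (x : 'rV[F]_((n * n) * (n * n))) :
  mmap i (x 0) sign_polynomial =
  proper_sign (invmx (map_mx i (gram q))) (map_mx i (gram q)) (vec_mx x).
Proof.
have coef (A : 'M[K]_n) : map_mx (mmap i (x 0)) (map_mx (@mpolyC _ K) A) = map_mx i A.
  by apply/matrixP => k l; rewrite !mxE mmapC.
rewrite /sign_polynomial map_proper_sign -map_invmx !coef; congr proper_sign.
by apply/matrixP => k l; rewrite !mxE /= mmapX mmap1U.
Qed.

Lemma PGO_similitude (F : fieldType) (i : {rmorphism K -> F}) x : PGO q i x ->
  exists g mu, [/\ similitude (map_mx i (gram q)) g mu, mu != 0 &
    vec_mx x = conj_mx (map_mx i (gram q)) g mu].
Proof.
have symF : (map_mx i (gram q))^T = map_mx i (gram q) by rewrite map_trmx symB.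
have unitF : map_mx i (gram q) \in unitmx by rewrite map_unitmx.
move=> Gx; have [g [mu [sg mu0 ug gA]]] := similitude_of_automorphism m_gt0 symF unitF Gx.
by exists g, mu; split=> //; apply: conj_mx_unique.
Qed.

Lemma sign_square (F : fieldType) (i : {rmorphism K -> F}) x : PGO q i x ->
  mmap i (x 0) sign_polynomial = 1 \/ mmap i (x 0) sign_polynomial = - 1.
Proof.
have unitF : map_mx i (gram q) \in unitmx by rewrite map_unitmx.
move=> /PGO_similitude [g [mu [sg mu0 ex]]].
rewrite mmap_sign_polynomial ex proper_sign_conj //.
have /eqP := det_similitude unitF sg; rewrite eqf_sqr => /orP[]/eqP ->.
  by left; rewrite divff ?expf_neq0.
by right; rewrite mulNr divff ?expf_neq0.
Qed.

(** On PGO the sign is 1 or -1, and it is 1 at the identity. *)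
Lemma sign_PGO_plus (F : fieldType) (i : {rmorphism K -> F}) x : PGO_plus q i x ->
  mmap i (x 0) sign_polynomial = 1.
Proof.
move=> [Gx cx].
have mm1 (L : fieldType) (j : {rmorphism K -> L}) (y : 'rV[L]_((n * n) * (n * n))) (c : K) :
    mmap j (y 0) (sign_polynomial + mpolyC _ c) = mmap j (y 0) sign_polynomial + j c.
  by rewrite rmorphD /= mmapC.
have : point_ideal (point_of i x) (sign_polynomial + mpolyC _ (-1)).
  apply: (component_zero_locus (p := sign_polynomial + mpolyC _ (-1))
    (r := sign_polynomial + mpolyC _ 1)) cx _.
  - move=> _ [L [j [y [Gy ->]]]] /=; rewrite !mm1 rmorphN !rmorph1.
    by case: (sign_square Gy) => ->; [left; rewrite subrr | right; rewrite addNr].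
  - move=> _ [L [j [y [Gy ->]]]] /=; rewrite !mm1 rmorphN !rmorph1.
    move=> /eqP; rewrite subr_eq0 => /eqP -> /eqP.
    have : j 2 != 0 by rewrite fmorph_eq0.
    by rewrite rmorph_nat => /negPf ->.
  - rewrite /= mm1 mmap_sign_polynomial mxvecK.
    have -> : (1%:M : 'M[K]_(n * n)) = conj_mx (map_mx idfun (gram q)) 1%:M 1.
      rewrite map_mx_id //; apply: conj_mx_unique => //; [exact: sim1|exact: oner_neq0|].
      by move=> A; rewrite /endo mulmx1 mxvecK mulmx1 mul1mx.
    by rewrite map_mx_id // proper_sign_conj // det1 expr1n divr1 subrr.
by rewrite /= mm1 rmorphN rmorph1 => /eqP; rewrite subr_eq0 => /eqP.
Qed.
End Points.

(** * Quadratic extensions and their norm forms *)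

(** By Cayley-Hamilton, a square root of d that is not scalar has trace 0. *)
Lemma det2_sqrt (F : fieldType) k (D : 'M[F]_k) (d r s : F) : k = 2 ->
  D *m D = d%:M -> (forall a, D <> a%:M) -> \det (r%:M + s *: D) = qnorm d r s.
Proof.
move=> k2; subst k => DD nscal.
pose i0 : 'I_2 := ord0; pose i1 : 'I_2 := lift ord0 ord0.
have e00 : D i0 i0 ^+ 2 + D i0 i1 * D i1 i0 = d.
  by have /matrixP /(_ i0 i0) := DD; rewrite !mxE !big_ord_recl big_ord0 addr0 mulr1n.
have e01 : D i0 i1 * (D i0 i0 + D i1 i1) = 0.
  have /matrixP /(_ i0 i1) := DD; rewrite !mxE !big_ord_recl big_ord0 addr0 mulr0n => <-.
  by rewrite -/i1; ring.
have e10 : D i1 i0 * (D i0 i0 + D i1 i1) = 0.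
  have /matrixP /(_ i1 i0) := DD; rewrite !mxE !big_ord_recl big_ord0 addr0 mulr0n => <-.
  by rewrite -/i1; ring.
have e11 : D i1 i1 ^+ 2 + D i0 i1 * D i1 i0 = d.
  have /matrixP /(_ i1 i1) := DD; rewrite !mxE !big_ord_recl big_ord0 addr0 mulr1n => <-.
  by rewrite -/i1; ring.
have tr0 : D i0 i0 + D i1 i1 = 0.
  apply/eqP/negPn/negP => t0; apply: (nscal (D i0 i0)).
  have b0 : D i0 i1 = 0 by apply: (mulIf t0); rewrite mul0r.
  have c0 : D i1 i0 = 0 by apply: (mulIf t0); rewrite mul0r.
  have a0 : D i0 i0 = D i1 i1.
    apply/eqP; rewrite -subr_eq0; apply/eqP; apply: (mulIf t0).
    by rewrite mul0r -subr_sqr; apply/eqP; rewrite subr_eq0 -(inj_eq (addIr (D i0 i1 * D i1 i0))) e00 e11.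
  apply/matrixP => i j; rewrite mxE.
  case: i => [[|[|//]] hi]; case: j => [[|[|//]] hj] //=.
  - by rewrite mulr1n; congr (D _ _); apply: val_inj.
  - by rewrite mulr0n -b0; congr (D _ _); apply: val_inj.
  - by rewrite mulr0n -c0; congr (D _ _); apply: val_inj.
  - by rewrite mulr1n a0; congr (D _ _); apply: val_inj.
rewrite (expand_det_row _ i0) !big_ord_recl big_ord0 /cofactor !det_mx11 !mxE /=.
have -> : lift i0 0 = i1 by apply: val_inj.
have -> : lift i1 0 = i0 by apply: val_inj.
rewrite -/i0 -/i1 !mulr1n !mulr0n expr0 expr1 /qnorm -e00.
have -> : D i1 i1 = - D i0 i0 by apply/eqP; rewrite -addr_eq0 addrC tr0.
ring.
Qed.

Section QuadraticExtension.
Variables (K : fieldType) (E : fieldExtType K).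
Hypothesis two_neq0 : 2 != 0 :> K.
Hypothesis dimE : \dim {:E} = 2.

(** Complete the square in the quadratic equation of an element outside K. *)
Lemma quadratic_generator : exists (d : K) (th : E),
  [/\ d != 0, th * th = d%:A, th \notin 1%VS & forall x, exists r s : K, x = r%:A + s *: th].
Proof.
have [x x1] : exists x : E, x \notin 1%VS.
  have : ~~ ({:E} <= 1)%VS.
    by apply/negP => /dimvS; rewrite dimE dimv1.
  by case/subvPn => x _ nx; exists x.
have full : (1 + <[x]>)%VS = fullv.
  apply/eqP; rewrite eqEdim subvf dimE.
  have := dimv_leqif_sup (addvSl 1%VS <[x]>%VS); rewrite dimv1 => -[le eq].
  rewrite ltn_neqAle le eq andbT subv_add subvv /=.
  by rewrite -memvE.
have decomp y : exists r s : K, y = r%:A + s *: x.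
  have : y \in (1 + <[x]>)%VS by rewrite full memvf.
  case/memv_addP => u /vlineP[r ->] [v /vlineP[s ->] ->].
  by exists r, s.
have [c [b xx]] := decomp (x * x).
have [e be] : exists e, b = e * 2 by exists (b / 2); rewrite divfK.
pose th := x - e%:A; exists (c + e ^+ 2), th.
have thth : th * th = (c + e ^+ 2)%:A.
  have -> : th * th = x * x - b *: x + (e ^+ 2)%:A.
    rewrite be expr2 -!scalerA scaler_nat -[e *: (x *+ 2)]mulr_algl.
    by rewrite -[e *: (_%:A)]mulr_algl /th; ring.
  by rewrite xx addrK -scalerDl.
have thn : th \notin 1%VS.
  apply: contra x1 => th1; rewrite -[x](subrK e%:A); apply: rpredD => //.
  by apply: rpredZ; apply: mem1v.
split=> //.
  apply: contra thn => /eqP d0; move/eqP: thth; rewrite d0 scale0r mulf_eq0 orbb => /eqP ->.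
  exact: mem0v.
move=> y; have [r [s ->]] := decomp y; exists (r + s * e), s.
rewrite /th scalerBr scalerDl scalerA -addrA; congr (_ + _).
by rewrite [RHS]addrC subrK.
Qed.

Lemma norm_form_generator d th r s : th * th = d%:A -> th \notin 1%VS ->
  norm_form (r%:A + s *: th : E) = qnorm d r s.
Proof.
move=> thth th1.
pose M x := passmx.mxof (vbasis {:E}) (vbasis {:E}) (amull x).
have vb : basis_of {:E} (vbasis {:E}) by apply: vbasisP.
have M1 : M 1 = 1%:M by rewrite /M amull1 passmx.mxof1 // (basis_free vb).
have mZ a h : passmx.mxof (vbasis {:E}) (vbasis {:E}) (a *: h) =
    a *: passmx.mxof (vbasis {:E}) (vbasis {:E}) h.
  rewrite -[a *: h]addr0 passmx.mxof_linear.
  have -> : passmx.mxof (vbasis {:E}) (vbasis {:E}) 0 = 0.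
    by apply/eqP; rewrite passmx.mxof_eq0.
  by rewrite addr0.
have ML a b x y : M (a *: x + b *: y) = a *: M x + b *: M y.
  rewrite /M !linearD /= !linearZ /=.
  by rewrite passmx.mxof_linear mZ.
have MM : M th *m M th = d%:M.
  rewrite -scalemx1 -M1 /M -passmx.mxof_comp //.
  have -> : (amull th \o amull th)%VF = amull (th * th) by rewrite amullM.
  by rewrite thth linearZ /= mZ.
rewrite /norm_form -/(M _) ML M1 scalemx1; apply: det2_sqrt => // a Ma.
move/negP: th1; apply; have : M (th - a%:A) = 0.
  by rewrite -[th]scale1r -scaleNr ML M1 Ma scale1r scalemx1 raddfN subrr.
move/eqP; rewrite passmx.mxof_eq0 // => /eqP /lfunP /(_ 1).
rewrite !lfunE /= mulr1 => /eqP; rewrite subr_eq0 => /eqP ->.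
by apply: rpredZ; apply: mem1v.
Qed.
End QuadraticExtension.

(** * An orthogonal frame for a sum of scaled norm forms *)

Section Gram.
Variables (K : fieldType) (n : nat) (q : 'cV[K]_n -> K).
Hypothesis quad_q : quadratic_form q.

Lemma polarC (V : lmodType K) (r : V -> K) u v : polar r u v = polar r v u.
Proof. by rewrite /polar [u + v]addrC addrAC. Qed.

Lemma polarDZ a u v w : polar q (a *: u + v) w = a * polar q u w + polar q v w.
Proof. by case: quad_q => _; apply. Qed.

Lemma polar0l w : polar q 0 w = 0.
Proof.
have := polarDZ 1 0 0 w; rewrite scaler0 addr0 mul1r => /eqP.
by rewrite -subr_eq0 opprD addrA subrr sub0r oppr_eq0 => /eqP.
Qed.

Lemma polar_suml m (a : 'I_m -> K) (u : 'I_m -> 'cV_n) w :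
  polar q (\sum_k a k *: u k) w = \sum_k a k * polar q (u k) w.
Proof. by elim/big_rec2: _ => [|k x y _ <-]; [exact: polar0l | exact: polarDZ]. Qed.

Lemma col_sum_delta (u : 'cV[K]_n) : u = \sum_k u k 0 *: delta_mx k 0.
Proof.
apply/matrixP => i j; rewrite summxE ord1 (bigD1 i) //= !mxE !eqxx mulr1.
by rewrite big1 ?addr0 // => k ki; rewrite !mxE eq_sym (negPf ki) mulr0.
Qed.

Lemma polar_gram u v : polar q u v = bil (gram q) u v.
Proof.
rewrite {1}[u]col_sum_delta polar_suml /bil -mulmxA mxE; apply: eq_bigr => k _.
rewrite [u^T _ _]mxE; congr (_ * _); rewrite polarC {1}[v]col_sum_delta polar_suml mxE.
by apply: eq_bigr => l _; rewrite mulrC [gram q _ _]mxE polarC.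
Qed.

Lemma gram_sym : (gram q)^T = gram q.
Proof. by apply/matrixP => i j; rewrite !mxE polarC. Qed.
End Gram.

Section Frame.
Variables (K : fieldType) (n : nat) (q : 'cV[K]_n -> K) (E : fieldExtType K).
Variables (m : nat) (a : 'I_m -> K) (d : K) (th : E).
Hypothesis two_neq0 : 2 != 0 :> K.
Hypothesis quad_q : quadratic_form q.
Hypothesis d_neq0 : d != 0.
Hypothesis a_neq0 : forall i, a i != 0.
Hypothesis decomp : forall x : E, exists r s : K, x = r%:A + s *: th.
Hypothesis norm_th : forall r s, norm_form (r%:A + s *: th : E) = qnorm d r s.
Hypothesis isom : isometric q (@scaled_norm_sum K E m a).

Let pN := polar (@norm_form K E).

Lemma polar_norm r s r' s' :
  pN (r%:A + s *: th) (r'%:A + s' *: th) = 2 * (r * r' - d * s * s').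
Proof.
rewrite /pN /polar addrACA -!scalerDl !norm_th /qnorm; ring.
Qed.

(** The columns of P are the vectors of q that correspond to 1 and sqrt d in the
m copies of E. *)
Lemma norm_frame : exists P : 'M[K]_(n, m + m),
  n = (m + m)%N /\ P^T *m gram q *m P = hermitian_gram d (\row_i (2 * a i)).
Proof.
have [f [[g fK gK] fq]] := isom.
pose single (j : 'I_m) (x : E) : {ffun 'I_m -> E} := [ffun k => if k == j then x else 0].
have pol u v : polar q u v = \sum_k a k * pN (f u k) (f v k).
  rewrite /polar -!fq linearD /scaled_norm_sum /pN /polar -!sumrB.
  by apply: eq_bigr => k _; rewrite ffunE !mulrBr.
have p10 : (1 : E) = 1%:A + 0 *: th by rewrite scale0r addr0 scale1r.
have pt0 : th = 0%:A + 1 *: th by rewrite scale0r add0r scale1r.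
have p00 : (0 : E) = 0%:A + 0 *: th by rewrite !scale0r addr0.
have N11 : pN 1 1 = 2.
  by have := polar_norm 1 0 1 0; rewrite -p10 => ->; ring.
have N1t : pN 1 th = 0.
  by have := polar_norm 1 0 0 1; rewrite -p10 -pt0 => ->; ring.
have Nt1 : pN th 1 = 0.
  by have := polar_norm 0 1 1 0; rewrite -p10 -pt0 => ->; ring.
have Ntt : pN th th = - 2 * d.
  by have := polar_norm 0 1 0 1; rewrite -pt0 => ->; ring.
have pol_single i j x y : polar q (g (single i x)) (g (single j y)) =
    if i == j then a i * pN x y else 0.
  have pN0 z : pN z 0 = 0 /\ pN 0 z = 0.
    have [r [s ->]] := decomp z; rewrite p00 !polar_norm; split; ring.
  rewrite pol !gK (bigD1 i) //= !ffunE eqxx big1 => [|k ki]; last first.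
    by rewrite !ffunE (negPf ki) (pN0 _).2 mulr0.
  by rewrite addr0; case: eqP => // _; rewrite (pN0 _).1 mulr0.
pose W x := \matrix_(k, j) g (single j x) k 0 : 'M[K]_(n, m).
have colW x j : col j (W x) = g (single j x).
  by apply/matrixP => k l; rewrite !mxE ord1.
pose P := row_mx (W 1) (W th).
have GW x y : (W x)^T *m gram q *m W y = diag_mx (\row_i (a i * pN x y)).
  apply/matrixP => i j; rewrite bil_col !colW -polar_gram // pol_single !mxE.
  by case: eqP => [->|_]; rewrite ?mulr1n.
have PP : P^T *m gram q *m P = hermitian_gram d (\row_i (2 * a i)).
  rewrite tr_row_mx mul_col_mx mul_col_row !GW /hermitian_gram -linearZ /=.
  congr block_mx; apply/matrixP => i j; rewrite !mxE.
  - by rewrite N11 mulrC.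
  - by rewrite N1t mulr0 mul0rn.
  - by rewrite Nt1 mulr0 mul0rn.
  - by rewrite Ntt; congr (_ *+ _); ring.
exists P; split=> //; apply/eqP; rewrite eqn_leq; apply/andP; split; last first.
  have uH : hermitian_gram d (\row_i (2 * a i)) \in unitmx.
    by apply: hermitian_gram_unit => // j; rewrite mxE mulf_neq0.
  move/mxrank_unit: uH => {1}<-; rewrite -PP.
  exact: leq_trans (mxrankM_maxr _ _) (rank_leq_row _).
rewrite -{1}(mxrank1 K n); apply: leq_trans (rank_leq_row P^T).
apply: mxrankS; apply/row_subP => i; apply/submxP.
pose v := (row i (1%:M : 'M[K]_n))^T.
have /choice [r /choice [s rs]] : forall k, exists r, exists s, f v k = r%:A + s *: th.
  by move=> k; apply: decomp.
exists (row_mx (\row_k r k) (\row_k s k)).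
apply: trmx_inj; rewrite trmx_mul trmxK -/v tr_row_mx mul_row_col.
rewrite -[LHS]fK -[RHS]fK; congr g.
have fW x (y : 'cV[K]_m) : f (W x *m y) = [ffun k => y k 0 *: x].
  have -> : W x *m y = \sum_j y j 0 *: g (single j x).
    rewrite {1}[y]col_sum_delta mulmx_sumr; apply: eq_bigr => j _.
    by rewrite -scalemxAr -colE colW.
  rewrite linear_sum; apply/ffunP => k; rewrite sum_ffunE ffunE (bigD1 k) //=.
  rewrite linearZ /= gK !ffunE eqxx big1 ?addr0 // => j jk.
  by rewrite linearZ /= gK !ffunE eq_sym (negPf jk) scaler0.
by rewrite linearD /= !fW; apply/ffunP => k; rewrite !ffunE !mxE rs.
Qed.
End Frame.

(** * R-triviality from paths *)

Lemma similitude_unique (F : fieldType) n (B g : 'M[F]_n) a b : (0 < n)%N ->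
  B \in unitmx -> similitude B g a -> similitude B g b -> a = b.
Proof.
move=> n0 uB sa sb; apply/eqP; rewrite -subr_eq0.
have : (a - b) *: B = 0 by rewrite scalerBl -sa -sb subrr.
by move/eqP; rewrite scaler_eq0 (negPf (unitmx_neq0 n0 uB)) orbF.
Qed.

Lemma takes_value_conj (F : fieldType) n (B : 'M[F]_n) (H : 'M[{poly F}]_n) nu a k :
  nu.[a] != 0 ->
  takes_value (mxvec (conj_mx (map_mx (@FracField.tofrac _) (map_mx polyC B))
      (map_mx (@FracField.tofrac _) H) (FracField.tofrac nu)) 0 k) a
    (mxvec (conj_mx B (evmx a H) nu.[a]) 0 k).
Proof.
move=> nua.
pose num := conj_numerator (map_mx polyC (invmx B)) (map_mx polyC B) H.
exists (mxvec num 0 k), nu; split=> //.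
  have lift (A : 'M[F]_n) : map_mx (@FracField.tofrac _) (map_mx polyC A) =
      map_mx (to_ratfun (idfun : {rmorphism F -> F})) A.
    by apply/matrixP => r s; rewrite !mxE.
  rewrite /conj_mx lift -map_invmx -!lift -map_conj_numerator -/num linearZ /= -map_mxvec.
  by rewrite mxE [X in _ * X]mxE mulrC.
rewrite /conj_mx linearZ mxE /= mulrC; congr (_ / _).
have -> : conj_numerator (invmx B) B (evmx a H) = evmx a num.
  by rewrite /num map_conj_numerator !evmxC.
by rewrite -map_mxvec [LHS]mxE.
Qed.

Section RPoints.
Variables (K : fieldType) (m : nat) (q : 'cV[K]_(m + m) -> K).
Hypothesis two_neq0 : 2 != 0 :> K.
Hypothesis m_gt0 : (0 < m + m)%N.
Let n := (m + m)%N.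
Hypothesis symB : (gram q)^T = gram q.
Hypothesis unitB : gram q \in unitmx.

(** The generic point f of the path specializes to both ends, so f and the two
ends lie in the same connected component. *)
Lemma path_directly_R_equivalent (F : fieldType) (i : {rmorphism K -> F}) x g mu :
    PGO q i x -> similitude (map_mx i (gram q)) g mu -> mu != 0 ->
    vec_mx x = conj_mx (map_mx i (gram q)) g mu ->
    polynomial_path (map_mx i (gram q)) g ->
  directly_R_equivalent (PGO_plus q) i (mxvec 1%:M) x.
Proof.
set B := map_mx i (gram q) => Gx sg mu0 ex [H [nu [c [c' [sH c0 c'0 H0 H1]]]]].
have sB : B^T = B by rewrite map_trmx symB.
have uB : B \in unitmx by rewrite map_unitmx.
have sev a : similitude B (evmx a H) nu.[a].
  by have := map_similitude (horner_eval a) sH; rewrite evmxC.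
have nu0 : nu.[0] = c ^+ 2.
  apply: (similitude_unique m_gt0 uB (sev 0)); rewrite H0 -scalemx1.
  by rewrite -[c ^+ 2]mulr1; apply: simZ; apply: sim1.
have nu1 : nu.[1] = c' ^+ 2 * mu.
  by apply: (similitude_unique m_gt0 uB (sev 1)); rewrite H1; apply: simZ.
have nu0n : nu.[0] != 0 by rewrite nu0 expf_neq0.
have nu1n : nu.[1] != 0 by rewrite nu1 mulf_neq0 ?expf_neq0.
pose BT := map_mx (@FracField.tofrac _) (map_mx polyC B).
have BTE : BT = map_mx (to_ratfun i) (gram q).
  by apply/matrixP => k l; rewrite !mxE.
have sBT : BT^T = BT by rewrite /BT 2!map_trmx sB.
have uBT : BT \in unitmx by rewrite BTE map_unitmx.
have sHT : similitude BT (map_mx (@FracField.tofrac _) H) (FracField.tofrac nu).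
  exact: map_similitude.
have nuT : FracField.tofrac nu != 0.
  by rewrite tofrac_eq0; apply: contraNneq nu0n => ->; rewrite horner0.
pose f := mxvec (conj_mx BT (map_mx (@FracField.tofrac _) H) (FracField.tofrac nu)).
have Gf : PGO q (to_ratfun i) f.
  suff : involution_automorphism BT (vec_mx f) by rewrite BTE.
  rewrite /f mxvecK.
  exact (conj_mx_automorphism sBT uBT sHT nuT).
have e0 : conj_mx B (evmx 0 H) nu.[0] = 1%:M.
  apply/esym/conj_mx_unique => // A.
  by rewrite H0 /endo mulmx1 mxvecK mul_mx_scalar mul_scalar_mx.
have e1 : mxvec (conj_mx B (evmx 1 H) nu.[1]) = x.
  rewrite -[RHS]vec_mxK; congr mxvec; apply/esym/conj_mx_unique => // A.
  rewrite ex H1 (endo_conj_mx B g mu) -scalemxAr -scalemxAl -[X in c' *: X = _]mulmxA.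
  by rewrite (sim_inverse uB sg mu0) mulmx1.
have v0 k : takes_value (f 0 k) 0 (mxvec 1%:M 0 k).
  by rewrite -e0; apply: takes_value_conj.
have v1 k : takes_value (f 0 k) 1 (x 0 k).
  by rewrite -e1; apply: takes_value_conj.
have spec a y : PGO q i y -> (forall k, takes_value (f 0 k) a (y 0 k)) ->
    connected_component (underlying_space (PGO q)) (point_of (to_ratfun i) f) (point_of i y).
  move=> Gy fy; apply: component_specialization.
  - by exists F, i, y.
  - by exists {fraction {poly F}}, (to_ratfun i), f.
  - move=> p /= pf; apply: (@takes_value_zero _ a); rewrite -pf.
    exact: takes_value_mmap.
have cf : connected_component (underlying_space (PGO q)) (point_of idfun (mxvec 1%:M))
    (point_of (to_ratfun i) f).
  have [G1 c1] := PGO_plus_one q i.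
  apply: connected_component_trans c1 _; apply: connected_component_sym.
  exact: spec v0.
split.
- exact: PGO_plus_one.
- split=> //; apply: connected_component_trans cf _; exact: spec v1.
- by exists f; split.
Qed.

(** Let g be a proper similitude of multiplier mu, and h the end of a path that
starts at 1 and has multiplier mu c^2 there. The determinant of the path is nu^m
up to a sign, which is 1 at t = 0; so h is proper, and c g h^-1 is an isometry of
determinant 1. *)
Lemma R_trivial_of_multiplier_paths (d : K) (c0 : 'rV[K]_m) (P : 'M[K]_n) :
    d != 0 -> (forall j, c0 0 j != 0) ->
    P^T *m gram q *m P = hermitian_gram d c0 ->
    (forall (F : fieldType) (i : {rmorphism K -> F}) g lam,
      similitude (hermitian_gram (i d) (map_mx i c0)) g lam ->
      exists nu c, [/\ c != 0, nu.[1] = lam * c ^+ 2 &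
        multiplier_path (hermitian_gram (i d) (map_mx i c0)) nu]) ->
  R_trivial (PGO_plus q).
Proof.
move=> d0 c00 PP mult F i; exists (mxvec 1%:M); split; first exact: PGO_plus_one.
move=> x Gx; apply: Relation_Operators.rst_step.
have sx := sign_PGO_plus two_neq0 m_gt0 symB unitB Gx.
have [g [mu [sg mu0 ex]]] := PGO_similitude m_gt0 symB unitB Gx.1.
apply: (path_directly_R_equivalent Gx.1 sg mu0 ex).
rewrite mmap_sign_polynomial // ex in sx; set B := map_mx i (gram q) in sg ex sx *.
have sB : B^T = B by rewrite map_trmx symB.
have uB : B \in unitmx by rewrite map_unitmx.
have twoF : 2 != 0 :> F by rewrite -(rmorph_nat i) fmorph_eq0.
have dg : \det g = mu ^+ m.
  rewrite proper_sign_conj // in sx.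
  by rewrite -[LHS](divfK (expf_neq0 m mu0)) sx mul1r.
pose Q := map_mx i P; pose dF := i d; pose cF := map_mx i c0.
have dF0 : dF != 0 by rewrite fmorph_eq0.
have cF0 j : cF 0 j != 0 by rewrite mxE fmorph_eq0.
have QQ : Q^T *m B *m Q = hermitian_gram dF cF.
  rewrite /Q /B map_trmx -!map_mxM PP /hermitian_gram map_block_mx !map_mx0 map_mxZ.
  by rewrite rmorphN map_diag_mx.
have QQd := QQ; rewrite hermitian_gram_diag in QQd.
have uQ : Q \in unitmx := unit_of_gram (hermitian_gram_neq0 dF0 cF0) QQd.
have [nu [c [cn0 nu1 mp]]] : exists nu c, [/\ c != 0, nu.[1] = mu * c ^+ 2 & multiplier_path B nu].
  have [|nu [c [cn0 nu1 mp]]] := mult F i (invmx Q *m g *m Q) mu.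
    rewrite /similitude -/dF -/cF -QQ -congruenceM -[invmx Q *m g *m Q]mulmxA.
    by rewrite mulKVmx // congruenceM sg -scalemxAr -scalemxAl.
  by exists nu, c; split=> //; apply: multiplier_path_congr uQ _; rewrite QQ.
have [M sM M0] := mp; pose h := evmx 1 M.
have sh : similitude B h (mu * c ^+ 2).
  by rewrite -nu1; have := map_similitude (horner_eval 1) sM; rewrite evmxC.
have nu0 : nu.[0] = 1.
  apply: (similitude_unique m_gt0 uB _ (sim1 B)).
  by rewrite -M0; have := map_similitude (horner_eval 0) sM; rewrite evmxC.
have dM : \det M = nu ^+ m.
  have : (\det M) ^+ 2 = (nu ^+ m) ^+ 2.
    have B0 : \det (map_mx polyC B) != 0.
      by rewrite det_map_mx polyC_eq0 -unitfE -unitmxE.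
    move/(congr1 determinant): sM; rewrite !det_mulmx det_tr detZ => e.
    apply: (mulIf B0); rewrite -exprM muln2 -addnn -e; ring.
  move/eqP; rewrite eqf_sqr => /orP[/eqP //|/eqP dM].
  have := congr1 (horner_eval 0) dM; rewrite -det_map_mx M0 det1 /horner_eval.
  rewrite hornerN horner_exp nu0 expr1n => /eqP.
  by rewrite -addr_eq0 -mulr2n (negPf twoF).
have dh : \det h = (mu * c ^+ 2) ^+ m.
  by rewrite /h det_map_mx dM /= /horner_eval horner_exp nu1.
have ph : polynomial_path B h.
  by exists M, nu, 1, 1; rewrite scale1r; split; rewrite ?oner_neq0.
have muc : mu * c ^+ 2 != 0 by rewrite mulf_neq0 ?expf_neq0.
have uh : h \in unitmx by rewrite unitmxE dh unitfE expf_neq0.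
pose k := c *: (g *m invmx h).
have kh : k *m h = c *: g by rewrite /k -scalemxAl mulmxKV.
have sk : similitude B k 1.
  have : similitude B (k *m h) (c ^+ 2 * mu) by rewrite kh; apply: simZ.
  rewrite /similitude congruenceM => e.
  apply: (can_inj (mulmxK uh)).
  have uhT : h^T \in unitmx by rewrite unitmx_tr.
  apply: (can_inj (mulKmx uhT)).
  by rewrite scale1r mulmxA e mulmxA sh mulrC.
have dk : \det k = 1.
  rewrite detZ det_mulmx det_inv dg dh exprMn addnn -mul2n exprM mulrA.
  by rewrite [X in X / _]mulrC divff // mulf_neq0 ?expf_neq0.
have pk : polynomial_path B k.
  exact: path_isometry twoF sB _ _ _ uQ QQd (hermitian_gram_neq0 dF0 cF0) sk dk.
have [H [eta [e [e' [sH e0 e'0 H0 H1]]]]] := polynomial_pathM pk ph.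
by exists H, eta, e, (e' * c); split; rewrite ?mulf_neq0 // H1 kh scalerA.
Qed.
End RPoints.

Lemma two_neq0_of_char (K : fieldType) : (2 \notin [pchar K])%N -> 2 != 0 :> K.
Proof. by apply: contra => two0; rewrite inE /= two0. Qed.

Lemma fmorph_two_neq0 (K F : fieldType) (i : {rmorphism K -> F}) :
  2 != 0 :> K -> 2 != 0 :> F.
Proof. by move=> two; rewrite -(rmorph_nat i) fmorph_eq0. Qed.

Lemma gram_unit (K : fieldType) m (q : 'cV[K]_(m + m) -> K) (d : K) (c0 : 'rV[K]_m)
    (P : 'M[K]_(m + m)) : d != 0 ->
  (forall j, c0 0 j != 0) -> P^T *m gram q *m P = hermitian_gram d c0 ->
  gram q \in unitmx.
Proof.
move=> d0 c00 PP; have := hermitian_gram_unit d0 c00.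
by rewrite -PP !unitmx_mul => /andP[/andP[]].
Qed.

Theorem corollary2p19 (K : fieldType) (charK : (2 \notin [pchar K])%N)
    (n : nat) (q : 'cV[K]_n -> K) (quad_q : quadratic_form q)
    (type_q : type_E7 q \/ type_E8 q) :
  R_trivial (PGO_plus q).
Proof.
have two := two_neq0_of_char charK.
case: type_q => -[_ [E [a [[dimE _] a0 isom disc]]]];
  have [d [th [d0 thth th1 decomp]]] := quadratic_generator two dimE;
  have norm_th r s := norm_form_generator dimE r s thth th1;
  have [P [en PP]] := norm_frame two quad_q d0 a0 decomp norm_th isom;
  subst n; set c0 := \row_i _ in PP;
  have c00 j : c0 0 j != 0 by rewrite mxE mulf_neq0.
- apply: (R_trivial_of_multiplier_paths two _ (gram_sym q) (gram_unit d0 c00 PP) d0 c00 PP) => //.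
  move=> F i g lam; apply: multiplier_path_rank4.
  + exact: fmorph_two_neq0 i two.
  + by rewrite fmorph_eq0.
  + by move=> j; rewrite mxE fmorph_eq0.
- apply: (R_trivial_of_multiplier_paths two _ (gram_sym q) (gram_unit d0 c00 PP) d0 c00 PP) => //.
  case: disc => x; have [r [s ->]] := decomp x; rewrite norm_th => rs.
  move=> F i g lam; apply: (@multiplier_path_rank6 _ _ _ _ _ (2 ^+ 3 * i r) (2 ^+ 3 * i s)).
  + exact: fmorph_two_neq0 i two.
  + by rewrite fmorph_eq0.
  + by move=> j; rewrite mxE fmorph_eq0.
  + have -> : \prod_j (map_mx i c0) 0 j = i (2 ^+ 6 * \prod_j a j).
      rewrite rmorphM rmorph_prod rmorphXn rmorph_nat -[X in _ ^+ X](card_ord 6).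
      rewrite -prodr_const -big_split /=; apply: eq_bigr => j _.
      by rewrite !mxE rmorphM rmorph_nat.
    have -> : \prod_j a j = - qnorm d r s by rewrite rs opprK.
    rewrite /qnorm !(rmorphM, rmorphN, rmorphB, rmorphXn, rmorph_nat) /=; ring.
Qed.
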